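(* Every art gallery with at most two reflex corners is normal.
   Context: An art gallery $\Gamma$ is a simple polygon in the plane (closed region: the boundary together with its interior), whose boundary is a simple closed curve made of finitely many line segments; the boundary is called the walls. A guard is a point of $\Gamma$. A guard $G$ visually covers a point $A\in\Gamma$ if the segment $GA$ is entirely contained in $\Gamma$ (touching the boundary is allowed). A configuration of guards is a finite set $F$ of points of $\Gamma$; it visually covers a set $X\subseteq\Gamma$ if every point of $X$ is visually covered by at least one guard of $F$. $\Gamma$ is normal if every configuration of guards that visually covers the walls of $\Gamma$ visually covers all of $\Gamma$. A reflex corner of $\Gamma$ is a corner at which the interior angle is greater than $180^\circ$. *)

(* Defs.v *)
From Stdlib Require Import Reals List Arith.
Open Scope R_scope.

Definition point : Type := (R * R)%type.

Definition lerp (a b : point) (t : R) : point :=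
  ((1 - t) * fst a + t * fst b, (1 - t) * snd a + t * snd b).

Definition on_seg (a b p : point) : Prop :=
  exists t, 0 <= t <= 1 /\ p = lerp a b t.

Definition nxt (n i : nat) : nat := Nat.modulo (S i) n.

Definition edge (n : nat) (v : nat -> point) (i : nat) (p : point) : Prop :=
  on_seg (v i) (v (nxt n i)) p.

Definition simple_polygon (n : nat) (v : nat -> point) : Prop :=
  (3 <= n)%nat /\
  (forall i j, (i < n)%nat -> (j < n)%nat -> i <> j -> v i <> v j) /\
  (forall i j p, (i < n)%nat -> (j < n)%nat -> i <> j ->
     edge n v i p -> edge n v j p ->
     (nxt n i = j /\ p = v j) \/ (nxt n j = i /\ p = v i)).

Definition on_boundary (n : nat) (v : nat -> point) (p : point) : Prop :=
  exists i, (i < n)%nat /\ edge n v i p.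

(* p (off the boundary) lies in a bounded connected component of the
   complement of the boundary: all continuous paths starting at p that avoid
   the boundary stay in a fixed bounded box. *)
Definition in_bounded_component (n : nat) (v : nat -> point) (p : point) : Prop :=
  exists M : R, forall fx fy : R -> R,
    continuity fx -> continuity fy ->
    fx 0 = fst p -> fy 0 = snd p ->
    (forall t, 0 <= t <= 1 -> ~ on_boundary n v (fx t, fy t)) ->
    forall t, 0 <= t <= 1 -> Rabs (fx t) <= M /\ Rabs (fy t) <= M.

Definition gallery (n : nat) (v : nat -> point) (p : point) : Prop :=
  on_boundary n v p \/ (~ on_boundary n v p /\ in_bounded_component n v p).

Definition covers (n : nat) (v : nat -> point) (g a : point) : Prop :=
  forall t, 0 <= t <= 1 -> gallery n v (lerp g a t).

Definition config_covers (n : nat) (v : nat -> point) (F : list point)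
  (X : point -> Prop) : Prop :=
  forall a, X a -> exists g, In g F /\ covers n v g a.

Definition normal (n : nat) (v : nat -> point) : Prop :=
  forall F : list point,
    (forall g, In g F -> gallery n v g) ->
    config_covers n v F (on_boundary n v) ->
    config_covers n v F (gallery n v).

(* Corner i (neighbours p = v (i-1), q = v (i+1)) is reflex, i.e. its interior
   angle exceeds 180 degrees, iff points near v i in the direction
   (p - v i) + (q - v i) (which lies in the open exterior wedge exactly when
   the interior angle is > 180) lie outside the gallery. *)
Definition prv (n i : nat) : nat := Nat.modulo (i + n - 1) n.

Definition reflex (n : nat) (v : nat -> point) (i : nat) : Prop :=
  let c := v i in let p := v (prv n i) in let q := v (nxt n i) in
  let d := (fst p - fst c + (fst q - fst c), snd p - snd c + (snd q - snd c)) in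
  exists s0, 0 < s0 /\
    forall s, 0 < s < s0 ->
      ~ gallery n v (fst c + s * fst d, snd c + s * snd d).

Definition at_most_two_reflex (n : nat) (v : nat -> point) : Prop :=
  exists l : list nat, (length l <= 2)%nat /\
    forall i, (i < n)%nat -> reflex n v i -> In i l.

(* Main.v *)
(* Let [a] be an interior point that no guard covers. The only topological fact
   needed is that the complement of the gallery is open and invariant along
   segments avoiding the walls; no Jordan curve theorem is used.

   If [a] and a guard [g] both see [w], sweep the segment from [a] over the
   triangle [a w g], from [w] towards [g]: it is first blocked by a reflex corner
   [a + r], with the exterior on the side of [g]. So [g] lies strictly on the
   pocket side of the line through [a] and that corner, and [w] lies strictly on
   the other side or on the ray from [a] through the corner. With two reflex
   corners, the directions excluding this for a given corner form a half-open
   half plane, and two of these have a common direction [u] unless the corners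
   are opposite as seen from [a] and their pockets lie on opposite sides. The
   wall point where the ray [a + t u] ends is then seen by no guard.

   In the opposite case tilt the ray towards one corner by a small angle, so that
   it is hidden from the pocket of that corner. If a guard sees the end of such
   rays for arbitrarily small angles, it sees a limit point of these ends, which
   contradicts the description of the blocking corner. As there are finitely many
   guards, one small angle serves all of them. *)
Require Import Defs.
From Stdlib Require Import Reals List Arith.
From Stdlib Require Import Lra Lia Classical ClassicalEpsilon.

(** * Plane vectors, and the exterior along segments that avoid the walls *)

Definition off (z : point) (x y : R) : point := (fst z + x, snd z + y).
Definition vec (a b : point) : point := (fst b - fst a, snd b - snd a).
Definition cross (p q : point) : R := fst p * snd q - snd p * fst q.
Definition dot (p q : point) : R := fst p * fst q + snd p * snd q.

Lemma point_eq (p q : point) : fst p = fst q -> snd p = snd q -> p = q.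
Proof. destruct p, q; simpl; intros; subst; reflexivity. Qed.

Lemma lerp_sym (p q : point) (t : R) : lerp q p t = lerp p q (1 - t).
Proof. apply point_eq; simpl; ring. Qed.

(** Prefixing a path from [q] with the segment from [p] to [q] gives a path from [p], so the bound
    [M] for [p] also serves [q]. *)
Lemma in_bounded_component_seg (n : nat) (v : nat -> point) (p q : point) :
  in_bounded_component n v p ->
  (forall t, 0 <= t <= 1 -> ~ on_boundary n v (lerp p q t)) ->
  in_bounded_component n v q.
Proof.
  intros [M HM] Hseg. exists M. intros fx fy cx cy fx0 fy0 Hf t Ht.
  (* [pos] is the positive part. Paths must be continuous on the whole line, so the two pieces are
     glued by formulas rather than by cases. *)
  pose (pos := fun y : R => (y + Rabs y) / 2).
  assert (pos_pos : forall y, 0 <= y -> pos y = y)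
    by (intros y Hy; unfold pos; rewrite Rabs_pos_eq; lra).
  assert (pos_neg : forall y, y <= 0 -> pos y = 0)
    by (intros y Hy; unfold pos; rewrite Rabs_left1; lra).
  assert (cpos : continuity pos) by (unfold pos; reg).
  (* As [s] goes from 0 to 1/2, [u] runs from 0 to 1 while [w] stays 0; then [u] stays 1 and [w]
     runs from 0 to 1. The sum in [cg] thus follows the segment first and [f] afterwards. *)
  pose (u := fun s => 1 - pos (1 - 2 * s)).
  pose (w := fun s => pos (2 * s - 1)).
  assert (cu : continuity u).
  { unfold u. apply (continuity_minus (fun _ => 1)); [reg|].
    apply (continuity_comp (fun s => 1 - 2 * s) pos); [reg|exact cpos]. }
  assert (cw : continuity w).
  { apply (continuity_comp (fun s => 2 * s - 1) pos); [reg|exact cpos]. }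
  assert (cg : forall a b (f : R -> R), continuity f ->
     continuity (fun s => ((1 - u s) * a + u s * b) + (f (w s) - b))).
  { intros a b f cf.
    apply (continuity_plus (fun s => (1 - u s) * a + u s * b)
             (fun s => f (w s) - b)).
    - apply (continuity_plus (fun s => (1 - u s) * a) (fun s => u s * b)).
      + apply (continuity_mult (fun s => 1 - u s) (fun _ => a)); [|reg].
        apply (continuity_minus (fun _ => 1) u); [reg|exact cu].
      + apply (continuity_mult u (fun _ => b)); [exact cu|reg].
    - apply (continuity_minus (fun s => f (w s)) (fun _ => b)); [|reg].
      apply (continuity_comp w f); assumption. }
  specialize (HM _ _ (cg (fst p) (fst q) fx cx) (cg (snd p) (snd q) fy cy)).
  assert (u0 : u 0 = 0) by (unfold u; rewrite pos_pos; lra).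
  assert (w0 : w 0 = 0) by (unfold w; rewrite pos_neg; lra).
  cbv beta in HM. rewrite u0, w0, fx0, fy0 in HM.
  assert (uL : forall s, s <= 1/2 -> u s = 2 * s)
    by (intros; unfold u; rewrite pos_pos; lra).
  assert (wL : forall s, s <= 1/2 -> w s = 0)
    by (intros; unfold w; rewrite pos_neg; lra).
  assert (uR : forall s, 1/2 <= s -> u s = 1)
    by (intros; unfold u; rewrite pos_neg; lra).
  assert (wR : forall s, 1/2 <= s -> w s = 2 * s - 1)
    by (intros; unfold w; rewrite pos_pos; lra).
  assert (HM' := HM ltac:(ring) ltac:(ring)); clear HM.
  assert (Hav : forall s, 0 <= s <= 1 ->
     ~ on_boundary n v ((1 - u s) * fst p + u s * fst q + (fx (w s) - fst q),
                        (1 - u s) * snd p + u s * snd q + (fy (w s) - snd q))).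
  { intros s Hs. destruct (Rle_dec s (1/2)) as [H|H].
    - rewrite uL, wL, fx0, fy0 by lra.
      replace (_, _) with (lerp p q (2 * s)) by (apply point_eq; simpl; ring).
      apply Hseg; lra.
    - rewrite uR, wR by lra.
      replace (_, _) with (fx (2 * s - 1), fy (2 * s - 1))
        by (apply point_eq; simpl; ring).
      apply Hf; lra. }
  specialize (HM' Hav ((1 + t) / 2) ltac:(lra)). cbv beta in HM'.
  rewrite uR, wR in HM' by lra.
  replace (2 * ((1 + t) / 2) - 1) with t in HM' by lra.
  replace ((1 - 1) * fst p + 1 * fst q + (fx t - fst q)) with (fx t) in HM' by ring.
  replace ((1 - 1) * snd p + 1 * snd q + (fy t - snd q)) with (fy t) in HM' by ring.
  exact HM'.
Qed.

Lemma not_gallery (n : nat) (v : nat -> point) (p : point) :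
  ~ gallery n v p -> ~ on_boundary n v p /\ ~ in_bounded_component n v p.
Proof. unfold gallery; tauto. Qed.

(** Run backwards, the segment would carry boundedness of the component from [q] to [p]. *)
Lemma exterior_seg (n : nat) (v : nat -> point) (p q : point) :
  ~ gallery n v p ->
  (forall t, 0 <= t <= 1 -> ~ on_boundary n v (lerp p q t)) ->
  ~ gallery n v q.
Proof.
  intros Hp Hs [Hb|[Hb Hq]]; apply not_gallery in Hp as [Hp1 Hp2].
  - apply (Hs 1); [lra|]. replace (lerp p q 1) with q; [exact Hb|].
    apply point_eq; simpl; ring.
  - apply Hp2, (in_bounded_component_seg _ _ q); [exact Hq|].
    intros t Ht. rewrite lerp_sym. apply Hs; lra.
Qed.

(** * Openness of the complement of the walls and of the exterior *)

Lemma sqr_sum_pos (x y : R) : x <> 0 \/ y <> 0 -> 0 < x * x + y * y.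
Proof.
  assert (Hx := Rle_0_sqr x). assert (Hy := Rle_0_sqr y). unfold Rsqr in *.
  intros [H|H]; apply Rsqr_pos_lt in H; unfold Rsqr in H; lra.
Qed.

(** If [z] is off the line through [a] and [b], the affine function vanishes on that line; if [z] is
    on the line beyond an end of the segment, it vanishes at that end and is measured along the
    line. Otherwise [d / N] would be the parameter of [z] on the segment. *)
Lemma seg_separation (a b z : point) :
  a <> b -> ~ on_seg a b z ->
  exists h k l, 0 < h * fst z + k * snd z + l /\
    forall p, on_seg a b p -> h * fst p + k * snd p + l <= 0.
Proof.
  destruct a as [a1 a2], b as [b1 b2], z as [z1 z2]; simpl. intros Hab Hz.
  pose (c := (b1 - a1) * (z2 - a2) - (b2 - a2) * (z1 - a1)).
  pose (N := (b1 - a1) * (b1 - a1) + (b2 - a2) * (b2 - a2)).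
  pose (d := (b1 - a1) * (z1 - a1) + (b2 - a2) * (z2 - a2)).
  assert (HN : 0 < N).
  { apply sqr_sum_pos. destruct (Req_dec a1 b1) as [->|H1]; [|left; lra].
    destruct (Req_dec a2 b2) as [->|H2]; [congruence|right; lra]. }
  destruct (Rlt_dec 0 (c * c)) as [Hc|Hc].
  { exists (- c * (b2 - a2)), (c * (b1 - a1)),
      (c * ((b2 - a2) * a1 - (b1 - a1) * a2)). split.
    - replace (_ + _) with (c * c) by (unfold c; ring). exact Hc.
    - intros p (t & Ht & ->); simpl. apply Req_le; ring. }
  assert (c0 : c = 0) by nra.
  destruct (Rlt_dec d 0) as [Hd|Hd].
  { exists (- (b1 - a1)), (- (b2 - a2)), ((b1 - a1) * a1 + (b2 - a2) * a2). split.
    - replace (_ + _) with (- d) by (unfold d; ring). lra.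
    - intros p (t & Ht & ->); simpl.
      replace (_ + _) with (- t * N) by (unfold N; ring). nra. }
  destruct (Rlt_dec N d) as [Hd'|Hd'].
  { exists (b1 - a1), (b2 - a2), (- ((b1 - a1) * b1 + (b2 - a2) * b2)). split.
    - replace (_ + _) with (d - N) by (unfold d, N; ring). lra.
    - intros p (t & Ht & ->); simpl.
      replace (_ + _) with (- (1 - t) * N) by (unfold N; ring). nra. }
  exfalso. apply Hz. exists (d / N). split.
  - split; [apply Rle_mult_inv_pos; lra|].
    apply (Rmult_le_reg_r N); [exact HN|]. unfold Rdiv.
    rewrite Rmult_assoc, Rinv_l; lra.
  (* Coordinates of [z - a] in the orthogonal basis formed by [b - a] and its quarter turn; the
     component [c] along the latter vanishes. *)
  - assert (E1 : (z1 - a1) * N = d * (b1 - a1)).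
    { transitivity (d * (b1 - a1) - c * (b2 - a2)); [unfold c, d, N; ring|].
      rewrite c0; ring. }
    assert (E2 : (z2 - a2) * N = d * (b2 - a2)).
    { transitivity (d * (b2 - a2) + c * (b1 - a1)); [unfold c, d, N; ring|].
      rewrite c0; ring. }
    apply point_eq; simpl; apply (Rmult_eq_reg_r N); try lra.
    + replace (((1 - d / N) * a1 + d / N * b1) * N)
        with (a1 * N + d * (b1 - a1)) by (field; lra). lra.
    + replace (((1 - d / N) * a2 + d / N * b2) * N)
        with (a2 * N + d * (b2 - a2)) by (field; lra). lra.
Qed.

(** The separating function has value [e] at [z] and drops by less than [e] in the box. *)
Lemma seg_far (a b z : point) :
  a <> b -> ~ on_seg a b z ->
  exists r, 0 < r /\ forall x y, Rabs x < r -> Rabs y < r -> ~ on_seg a b (off z x y).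
Proof.
  intros Hab Hz. destruct (seg_separation a b z Hab Hz) as (h & k & l & Hp & Hs).
  set (e := h * fst z + k * snd z + l) in *.
  assert (Hh := Rabs_pos h). assert (Hk := Rabs_pos k).
  exists (e / (Rabs h + Rabs k + 1)). split.
  { apply Rdiv_lt_0_compat; lra. }
  intros x y Hx Hy Hseg. apply Hs in Hseg. simpl in Hseg.
  set (r := e / _) in *.
  assert (Hr : r * (Rabs h + Rabs k + 1) = e) by (unfold r; field; lra).
  assert (Hm : forall c w, Rabs w < r -> - (c * w) <= Rabs c * r).
  { intros c w Hw. apply Rle_trans with (Rabs (- (c * w))); [apply Rle_abs|].
    rewrite Rabs_Ropp, Rabs_mult. apply Rmult_le_compat_l; [apply Rabs_pos|lra]. }
  assert (H1 := Hm h x Hx). assert (H2 := Hm k y Hy).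
  assert (H3 : 0 < r) by (unfold r; apply Rdiv_lt_0_compat; lra).
  unfold e in *. nra.
Qed.

Lemma nxt_spec (n i : nat) : (i < n)%nat ->
  (nxt n i < n)%nat /\
  ((S i < n)%nat /\ nxt n i = S i \/ S i = n /\ nxt n i = 0%nat).
Proof.
  intros Hi. unfold nxt. split; [apply Nat.mod_upper_bound; lia|].
  destruct (Nat.eq_dec (S i) n) as [E|E].
  - right. split; [exact E|]. rewrite E. apply Nat.Div0.mod_same.
  - left. split; [lia|]. apply Nat.mod_small; lia.
Qed.

Lemma prv_spec (n i : nat) : (i < n)%nat -> (prv n i < n)%nat /\ nxt n (prv n i) = i.
Proof.
  intros Hi. unfold prv.
  assert (H := Nat.mod_upper_bound (i + n - 1) n ltac:(lia)). split; [exact H|].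
  destruct i as [|i].
  - rewrite Nat.mod_small by lia. unfold nxt. replace (S (0 + n - 1)) with n by lia.
    apply Nat.Div0.mod_same.
  - replace (S i + n - 1)%nat with (i + 1 * n)%nat by lia.
    rewrite Nat.Div0.mod_add, Nat.mod_small by lia. unfold nxt.
    apply Nat.mod_small; lia.
Qed.

Lemma nxt_eq_prv (n i j : nat) : (i < n)%nat -> (j < n)%nat -> nxt n j = i -> j = prv n i.
Proof.
  intros Hi Hj E. destruct (prv_spec n i Hi) as [Hp Ep].
  destruct (nxt_spec n j Hj) as [_ H1]. destruct (nxt_spec n (prv n i) Hp) as [_ H2]. lia.
Qed.

Lemma edge_nondegenerate (n : nat) (v : nat -> point) (i : nat) :
  simple_polygon n v -> (i < n)%nat -> v i <> v (nxt n i).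
Proof.
  intros (Hn & Hinj & _) Hi. destruct (nxt_spec n i Hi) as [H1 H2].
  apply Hinj; lia.
Qed.

(** [Q] selects the edges to keep away from: all of them when [z] is off the walls, all but those
    through [z] when it is on them. *)
Lemma edges_far (n : nat) (v : nat -> point) (z : point) (Q : nat -> Prop) :
  simple_polygon n v ->
  (forall j, (j < n)%nat -> Q j -> ~ edge n v j z) ->
  exists r, 0 < r /\ forall x y, Rabs x < r -> Rabs y < r ->
    forall j, (j < n)%nat -> Q j -> ~ edge n v j (off z x y).
Proof.
  intros Hs HQ.
  assert (H : forall m, (m <= n)%nat -> exists r, 0 < r /\
    forall x y, Rabs x < r -> Rabs y < r ->
    forall j, (j < m)%nat -> Q j -> ~ edge n v j (off z x y)).
  { induction m as [|m IH]; intros Hm.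
    - exists 1. split; [lra|]. intros; lia.
    - destruct (IH ltac:(lia)) as (r & Hr & H).
      destruct (classic (Q m)) as [Qm|Qm].
      + destruct (seg_far (v m) (v (nxt n m)) z) as (r' & Hr' & H').
        { apply edge_nondegenerate; [exact Hs|lia]. }
        { apply (HQ m); [lia|exact Qm]. }
        exists (Rmin r r'). split; [apply Rmin_glb_lt; assumption|].
        intros x y Hx Hy j Hj Qj.
        assert (M1 := Rmin_l r r'). assert (M2 := Rmin_r r r').
        destruct (Nat.eq_dec j m) as [->|].
        * apply H'; lra.
        * apply H; try lra; try lia; assumption.
      + exists r. split; [exact Hr|]. intros x y Hx Hy j Hj Qj.
        destruct (Nat.eq_dec j m) as [->|]; [contradiction|].
        apply H; try lra; try lia; assumption. }
  apply (H n). lia.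
Qed.

Lemma off_boundary_open (n : nat) (v : nat -> point) (z : point) :
  simple_polygon n v -> ~ on_boundary n v z ->
  exists r, 0 < r /\ forall x y, Rabs x < r -> Rabs y < r -> ~ on_boundary n v (off z x y).
Proof.
  intros Hs Hz.
  destruct (edges_far n v z (fun _ => True) Hs) as (r & Hr & H).
  { intros j Hj _ He. apply Hz. exists j; auto. }
  exists r. split; [exact Hr|]. intros x y Hx Hy (j & Hj & He).
  exact (H x y Hx Hy j Hj I He).
Qed.

Lemma Rabs_lerp_lt (x y t r : R) :
  0 <= t <= 1 -> Rabs x < r -> Rabs y < r -> Rabs ((1 - t) * x + t * y) < r.
Proof.
  intros Ht Hx Hy. apply Rabs_def2 in Hx. apply Rabs_def2 in Hy.
  assert (H : forall a b, a < r -> b < r -> (1 - t) * a + t * b < r).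
  { intros a b Ha Hb. destruct (Req_dec t 0) as [->|H0]; [lra|].
    assert (0 < t * (r - b)) by (apply Rmult_lt_0_compat; lra).
    assert (0 <= (1 - t) * (r - a)) by (apply Rmult_le_pos; lra). lra. }
  assert (H1 := H x y ltac:(lra) ltac:(lra)).
  assert (H2 := H (- x) (- y) ltac:(lra) ltac:(lra)).
  apply Rabs_def1; lra.
Qed.

(** A box free of walls is convex, so it cannot contain both exterior points and gallery points. *)
Lemma exterior_box (n : nat) (v : nat -> point) (z : point) (r x y x' y' : R) :
  (forall x y, Rabs x < r -> Rabs y < r -> ~ on_boundary n v (off z x y)) ->
  Rabs x < r -> Rabs y < r -> Rabs x' < r -> Rabs y' < r ->
  ~ gallery n v (off z x y) -> ~ gallery n v (off z x' y').
Proof.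
  intros Hb Hx Hy Hx' Hy' Hg. apply (exterior_seg n v _ _ Hg). intros t Ht.
  replace (lerp _ _ t) with (off z ((1 - t) * x + t * x') ((1 - t) * y + t * y'))
    by (apply point_eq; simpl; ring).
  apply Hb; apply Rabs_lerp_lt; assumption.
Qed.

Lemma exterior_open (n : nat) (v : nat -> point) (z : point) :
  simple_polygon n v -> ~ gallery n v z ->
  exists r, 0 < r /\ forall x y, Rabs x < r -> Rabs y < r -> ~ gallery n v (off z x y).
Proof.
  intros Hs Hz. destruct (off_boundary_open n v z Hs) as (r & Hr & H).
  { apply not_gallery in Hz; tauto. }
  exists r. split; [exact Hr|]. intros x y Hx Hy.
  apply (exterior_box n v z r 0 0); try assumption; try (rewrite Rabs_R0; assumption).
  replace (off z 0 0) with z; [exact Hz|]. apply point_eq; simpl; ring.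
Qed.

(** * The exterior near a wall point *)

(** This is the direction [d] in the definition of [reflex]. *)
Definition corner_dir (n : nat) (v : nat -> point) (i : nat) : point :=
  (fst (v (prv n i)) - fst (v i) + (fst (v (nxt n i)) - fst (v i)),
   snd (v (prv n i)) - snd (v i) + (snd (v (nxt n i)) - snd (v i))).

Lemma vec_nonzero (a b : point) : a <> b -> fst (vec a b) <> 0 \/ snd (vec a b) <> 0.
Proof.
  intros H. destruct (Req_dec (fst (vec a b)) 0) as [H1|]; [|auto].
  destruct (Req_dec (snd (vec a b)) 0) as [H2|]; [|auto].
  exfalso. apply H. simpl in H1, H2. apply point_eq; lra.
Qed.

Lemma vertex_edges (n : nat) (v : nat -> point) (i j : nat) :
  simple_polygon n v -> (i < n)%nat -> (j < n)%nat ->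
  edge n v j (v i) -> j = i \/ j = prv n i.
Proof.
  intros (Hn & Hinj & Hs) Hi Hj He.
  destruct (Nat.eq_dec j i) as [|Hji]; [auto|right].
  destruct (Hs i j (v i) Hi Hj ltac:(auto)) as [[_ H]|[H _]]; auto.
  - exists 0. split; [lra|]. apply point_eq; simpl; ring.
  - exfalso. apply (Hinj i j); auto.
  - apply nxt_eq_prv; auto.
Qed.

(** Near [z] the walls form two rays, towards both neighbours if [z] is a corner and towards both
    ends of its edge otherwise. As [p] and [q] reach to those points, the rays are walls up to
    [e = 1]. Inside an edge they are parallel, so a nonzero cross product indicates a corner. *)
Lemma boundary_local (n : nat) (v : nat -> point) (z : point) :
  simple_polygon n v -> on_boundary n v z ->
  exists (p q : point) (r : R),
    (fst p <> 0 \/ snd p <> 0) /\ (fst q <> 0 \/ snd q <> 0) /\ 0 < r /\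
    (forall x y, Rabs x < r -> Rabs y < r -> on_boundary n v (off z x y) ->
       exists e, 0 <= e /\
         (x = e * fst p /\ y = e * snd p \/ x = e * fst q /\ y = e * snd q)) /\
    (forall e, 0 <= e <= 1 ->
       on_boundary n v (off z (e * fst p) (e * snd p)) /\
       on_boundary n v (off z (e * fst q) (e * snd q))) /\
    (cross p q <> 0 -> exists i, (i < n)%nat /\ z = v i /\
       corner_dir n v i = (fst p + fst q, snd p + snd q)).
Proof.
  intros Hs Hb. destruct (classic (exists i, (i < n)%nat /\ z = v i)) as [(i & Hi & ->)|Hv].
  - destruct (prv_spec n i Hi) as [Hp Ep].
    assert (Np := edge_nondegenerate n v (prv n i) Hs Hp). rewrite Ep in Np.
    destruct (edges_far n v (v i) (fun j => j <> i /\ j <> prv n i) Hs) as (r & Hr & H).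
    { intros j Hj Hne He. destruct (vertex_edges n v i j Hs Hi Hj He); tauto. }
    exists (vec (v i) (v (prv n i))), (vec (v i) (v (nxt n i))), r.
    split; [apply vec_nonzero; congruence|].
    split; [apply vec_nonzero, edge_nondegenerate; assumption|].
    split; [exact Hr|]. split; [|split].
    + intros x y Hx Hy (j & Hj & He).
      destruct (Nat.eq_dec j i) as [->|Hji].
      { destruct He as (t & Ht & E). exists t. split; [lra|right].
        assert (E1 := f_equal fst E). assert (E2 := f_equal snd E). simpl in *. lra. }
      destruct (Nat.eq_dec j (prv n i)) as [->|Hjp].
      { destruct He as (t & Ht & E). rewrite Ep in E.
        exists (1 - t). split; [lra|left].
        assert (E1 := f_equal fst E). assert (E2 := f_equal snd E). simpl in *. lra. }
      exfalso. apply (H x y Hx Hy j Hj); auto.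
    + intros e He. split.
      * exists (prv n i). split; [exact Hp|]. exists (1 - e). split; [lra|].
        rewrite Ep. apply point_eq; simpl; ring.
      * exists i. split; [exact Hi|]. exists e. split; [lra|].
        apply point_eq; simpl; ring.
    + intros _. exists i. auto.
  - destruct Hb as (i & Hi & t0 & Ht0 & Ez).
    destruct (nxt_spec n i Hi) as [Hni _].
    assert (T0 : t0 <> 0).
    { intros ->. apply Hv. exists i. split; [exact Hi|]. rewrite Ez.
      apply point_eq; simpl; ring. }
    assert (T1 : t0 <> 1).
    { intros ->. apply Hv. exists (nxt n i). split; [exact Hni|]. rewrite Ez.
      apply point_eq; simpl; ring. }
    destruct (edges_far n v z (fun j => j <> i) Hs) as (r & Hr & H).
    { intros j Hj Hne He. destruct Hs as (_ & _ & Hs).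
      destruct (Hs i j z Hi Hj ltac:(auto)) as [[_ H]|[_ H]].
      - exists t0; auto.
      - exact He.
      - apply Hv; exists j; auto.
      - apply Hv; exists i; auto. }
    exists (vec z (v i)), (vec z (v (nxt n i))), r.
    split; [apply vec_nonzero; intros E; apply Hv; exists i; auto|].
    split; [apply vec_nonzero; intros E; apply Hv; exists (nxt n i); auto|].
    split; [exact Hr|]. split; [|split].
    + intros x y Hx Hy (j & Hj & He).
      destruct (Nat.eq_dec j i) as [->|Hji]; [|exfalso; apply (H x y Hx Hy j Hj); auto].
      destruct He as (t & Ht & E).
      assert (E1 := f_equal fst E). assert (E2 := f_equal snd E).
      rewrite Ez in E1, E2 |- *. simpl in *.
      set (a1 := fst (v i)) in *. set (a2 := snd (v i)) in *.
      set (b1 := fst (v (nxt n i))) in *. set (b2 := snd (v (nxt n i))) in *.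
      assert (X1 : x = (t - t0) * (b1 - a1)) by lra.
      assert (X2 : y = (t - t0) * (b2 - a2)) by lra.
      (* Beyond [t0] the point lies towards [v (nxt n i)], before it towards [v i]; the witness is
         the fraction of the way from [z] to that end. *)
      destruct (Rle_dec t0 t) as [Hle|Hle].
      * exists ((t - t0) / (1 - t0)). split; [apply Rle_mult_inv_pos; lra|right].
        rewrite X1, X2; split; field; lra.
      * exists ((t0 - t) / t0). split; [apply Rle_mult_inv_pos; lra|left].
        rewrite X1, X2; split; field; lra.
    + intros e He. rewrite Ez. split; exists i; (split; [exact Hi|]).
      * exists ((1 - e) * t0). split; [nra|]. apply point_eq; simpl; ring.
      * exists ((1 - e) * t0 + e). split; [nra|]. apply point_eq; simpl; ring.
    + intros Hc. exfalso. apply Hc. rewrite Ez. unfold cross; simpl; ring.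
Qed.

(** An exterior point near [z] lies in a half plane, or in a wedge cut out by two half planes, that
    misses both wall rays. By convexity this whole region is exterior near [z]. A wedge occurs only
    between the two rays of a corner, and it contains [corner_dir]. *)
Lemma exterior_convex_cone (n : nat) (v : nat -> point) (z : point) :
  simple_polygon n v -> on_boundary n v z ->
  exists r, 0 < r /\ forall x0 y0, Rabs x0 < r -> Rabs y0 < r ->
    ~ gallery n v (off z x0 y0) ->
    exists h1 h2 k1 k2,
      0 < h1 * x0 + h2 * y0 /\ 0 < k1 * x0 + k2 * y0 /\
      (forall x y, Rabs x < r -> Rabs y < r ->
         0 < h1 * x + h2 * y -> 0 < k1 * x + k2 * y -> ~ gallery n v (off z x y)) /\
      (h1 = k1 /\ h2 = k2 \/
       exists i, (i < n)%nat /\ z = v i /\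
         0 < h1 * fst (corner_dir n v i) + h2 * snd (corner_dir n v i) /\
         0 < k1 * fst (corner_dir n v i) + k2 * snd (corner_dir n v i)).
Proof.
  intros Hs Hb.
  destruct (boundary_local n v z Hs Hb) as (p & q & r & Np & Nq & Hr & Hloc & Hray & Hcor).
  assert (Mpos : forall u : point, fst u <> 0 \/ snd u <> 0 -> 0 < Rmax (Rabs (fst u)) (Rabs (snd u))).
  { intros u [Hu|Hu]; apply Rabs_pos_lt in Hu.
    - apply Rlt_le_trans with (2 := Rmax_l _ _); exact Hu.
    - apply Rlt_le_trans with (2 := Rmax_r _ _); exact Hu. }
  (* Below the maximum norms of [p] and [q], a point of the box on one of the rays has [e <= 1] and
     hence really is on a wall. *)
  pose (r' := Rmin r (Rmin (Rmax (Rabs (fst p)) (Rabs (snd p))) (Rmax (Rabs (fst q)) (Rabs (snd q))))).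
  exists r'.
  assert (L1 : r' <= r) by apply Rmin_l.
  assert (L2 : r' <= Rmax (Rabs (fst p)) (Rabs (snd p))).
  { eapply Rle_trans; [apply Rmin_r|apply Rmin_l]. }
  assert (L3 : r' <= Rmax (Rabs (fst q)) (Rabs (snd q))).
  { eapply Rle_trans; [apply Rmin_r|apply Rmin_r]. }
  assert (Hr' : 0 < r') by (repeat apply Rmin_glb_lt; auto).
  clearbody r'. split; [exact Hr'|].
  intros x0 y0 Hx0 Hy0 Hg.
  assert (Hnb : ~ on_boundary n v (off z x0 y0)) by (apply not_gallery in Hg; tauto).
  assert (Hlt1 : forall u : point, r' <= Rmax (Rabs (fst u)) (Rabs (snd u)) ->
     forall e, 0 <= e -> x0 = e * fst u -> y0 = e * snd u -> e <= 1).
  { intros u Hu e He E1 E2. apply Rnot_lt_le. intros He1.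
    assert (Rabs (fst u) < r').
    { apply Rle_lt_trans with (2 := Hx0). rewrite E1, Rabs_mult, (Rabs_pos_eq e) by lra.
      assert (Hp := Rabs_pos (fst u)). nra. }
    assert (Rabs (snd u) < r').
    { apply Rle_lt_trans with (2 := Hy0). rewrite E2, Rabs_mult, (Rabs_pos_eq e) by lra.
      assert (Hp := Rabs_pos (snd u)). nra. }
    assert (Rmax (Rabs (fst u)) (Rabs (snd u)) < r') by (apply Rmax_lub_lt; assumption).
    lra. }
  assert (Hp0 : forall e, 0 <= e -> ~ (x0 = e * fst p /\ y0 = e * snd p)).
  { intros e He [E1 E2]. apply Hnb. rewrite E1, E2. apply Hray.
    split; [exact He|]. apply (Hlt1 p); auto. }
  assert (Hq0 : forall e, 0 <= e -> ~ (x0 = e * fst q /\ y0 = e * snd q)).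
  { intros e He [E1 E2]. apply Hnb. rewrite E1, E2. apply Hray.
    split; [exact He|]. apply (Hlt1 q); auto. }
  (* The segment from the exterior point stays where both forms are positive, while on each ray one
     of them is nonpositive. *)
  assert (Hcone : forall h1 h2 k1 k2,
     0 < h1 * x0 + h2 * y0 -> 0 < k1 * x0 + k2 * y0 ->
     (h1 * fst p + h2 * snd p <= 0 \/ k1 * fst p + k2 * snd p <= 0) ->
     (h1 * fst q + h2 * snd q <= 0 \/ k1 * fst q + k2 * snd q <= 0) ->
     forall x y, Rabs x < r' -> Rabs y < r' ->
         0 < h1 * x + h2 * y -> 0 < k1 * x + k2 * y -> ~ gallery n v (off z x y)).
  { intros h1 h2 k1 k2 Hh0 Hk0 Hp Hq x y Hx Hy Hh Hk.
    apply (exterior_seg n v _ _ Hg). intros t Ht Hbt.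
    replace (lerp _ _ t) with (off z ((1 - t) * x0 + t * x) ((1 - t) * y0 + t * y)) in Hbt
      by (apply point_eq; simpl; ring).
    assert (Pos : forall l1 l2, 0 < l1 * x0 + l2 * y0 -> 0 < l1 * x + l2 * y ->
      0 < l1 * ((1 - t) * x0 + t * x) + l2 * ((1 - t) * y0 + t * y)).
    { intros l1 l2 A B.
      replace (_ + _) with ((1 - t) * (l1 * x0 + l2 * y0) + t * (l1 * x + l2 * y)) by ring.
      destruct (Req_dec t 0) as [->|H0]; [lra|].
      assert (0 < t * (l1 * x + l2 * y)) by (apply Rmult_lt_0_compat; lra).
      assert (0 <= (1 - t) * (l1 * x0 + l2 * y0)) by (apply Rmult_le_pos; lra). lra. }
    assert (Ph := Pos _ _ Hh0 Hh). assert (Pk := Pos _ _ Hk0 Hk).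
    apply Hloc in Hbt; try (apply Rlt_le_trans with (2 := L1); apply Rabs_lerp_lt; assumption).
    destruct Hbt as (e & He & [[E1 E2]|[E1 E2]]); rewrite E1, E2 in Ph, Pk; nra. }
  set (C := cross p q) in *.
  destruct (Req_dec C 0) as [HC|HC].
  - assert (HC' := HC). unfold C, cross in HC'.
    (* The rays are parallel. If the exterior point is off their line, its side of the line serves.
       If it is on the line, it lies behind both rays, which then point the same way, and the half
       plane facing away from them serves. *)
    pose (m := fst p * y0 - snd p * x0).
    destruct (Req_dec m 0) as [Hm|Hm].
    + assert (Pp := sqr_sum_pos _ _ Np).
      set (N := fst p * fst p + snd p * snd p) in *.
      pose (D := fst p * x0 + snd p * y0).
      assert (X1 : x0 * N = D * fst p).
      { transitivity (D * fst p - m * snd p); [unfold D, N, m; ring|]. rewrite Hm; ring. }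
      assert (X2 : y0 * N = D * snd p).
      { transitivity (D * snd p + m * fst p); [unfold D, N, m; ring|]. rewrite Hm; ring. }
      destruct (Rlt_dec D 0) as [HD|HD].
      2:{ exfalso. apply (Hp0 (D / N)); [apply Rle_mult_inv_pos; lra|].
          split; apply (Rmult_eq_reg_r N); try lra.
          - rewrite X1. field. lra.
          - rewrite X2. field. lra. }
      pose (L := fst p * fst q + snd p * snd q).
      assert (Y1 : fst q * N = L * fst p).
      { transitivity (L * fst p - (fst p * snd q - snd p * fst q) * snd p);
          [unfold L, N; ring|]. rewrite HC'; ring. }
      assert (Y2 : snd q * N = L * snd p).
      { transitivity (L * snd p + (fst p * snd q - snd p * fst q) * fst p);
          [unfold L, N; ring|]. rewrite HC'; ring. }
      destruct (Rlt_dec L 0) as [HL|HL].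
      { exfalso. apply (Hq0 (D / L)).
        - replace (D / L) with ((- D) / (- L)) by (field; lra).
          apply Rle_mult_inv_pos; lra.
        - split; apply (Rmult_eq_reg_r N); try lra.
          + rewrite Rmult_assoc, Y1, X1. field. lra.
          + rewrite Rmult_assoc, Y2, X2. field. lra. }
      exists (- fst p), (- snd p), (- fst p), (- snd p).
      assert (HD' : 0 < - fst p * x0 + - snd p * y0) by (unfold D in HD; lra).
      split; [exact HD'|]. split; [exact HD'|]. split; [|left; split; reflexivity].
      apply Hcone; try exact HD'.
      * left. unfold N in Pp. lra.
      * left. unfold L in HL. lra.
    + assert (Pm : 0 < - m * snd p * x0 + m * fst p * y0).
      { replace (_ + _) with (m * m) by (unfold m; ring).
        apply Rsqr_pos_lt in Hm. exact Hm. }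
      exists (- m * snd p), (m * fst p), (- m * snd p), (m * fst p).
      split; [exact Pm|]. split; [exact Pm|]. split; [|left; split; reflexivity].
      apply Hcone; try exact Pm.
      * left. apply Req_le; ring.
      * left. apply Req_le. transitivity (m * (fst p * snd q - snd p * fst q)); [ring|].
        rewrite HC'; ring.
  (* Coordinates of the exterior point in the basis [p], [q]. Where one of them is negative there is
     a half plane missing both rays; if both are positive, the wedge between the rays contains the
     point, and also [p + q]. *)
  - pose (a := (x0 * snd q - y0 * fst q) / C).
    pose (b := (fst p * y0 - snd p * x0) / C).
    assert (HC' : fst p * snd q - snd p * fst q <> 0) by exact HC.
    assert (X1 : x0 = a * fst p + b * fst q) by (unfold a, b, C, cross; field; exact HC').
    assert (X2 : y0 = a * snd p + b * snd q) by (unfold a, b, C, cross; field; exact HC').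
    assert (Ha : forall x y, snd q / C * x + - fst q / C * y = (x * snd q - y * fst q) / C)
      by (intros; field; exact HC).
    assert (Hb' : forall x y, - snd p / C * x + fst p / C * y = (fst p * y - snd p * x) / C)
      by (intros; field; exact HC).
    assert (Hap : (fst p * snd q - snd p * fst q) / C = 1) by (unfold C, cross; field; exact HC').
    assert (Haq : (fst q * snd q - snd q * fst q) / C = 0) by (unfold C, cross; field; exact HC').
    assert (Hbp : (fst p * snd p - snd p * fst p) / C = 0) by (unfold C, cross; field; exact HC').
    destruct (Rlt_dec a 0) as [Ha0|Ha0].
    { exists (- (snd q / C)), (- (- fst q / C)), (- (snd q / C)), (- (- fst q / C)).
      assert (P : 0 < - (snd q / C) * x0 + - (- fst q / C) * y0).
      { assert (E := Ha x0 y0). fold a in E. lra. }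
      split; [exact P|]. split; [exact P|]. split; [|left; split; reflexivity].
      apply Hcone; try exact P; left.
      - assert (E := Ha (fst p) (snd p)). lra.
      - assert (E := Ha (fst q) (snd q)). lra. }
    destruct (Rlt_dec b 0) as [Hb0|Hb0].
    { exists (- (- snd p / C)), (- (fst p / C)), (- (- snd p / C)), (- (fst p / C)).
      assert (P : 0 < - (- snd p / C) * x0 + - (fst p / C) * y0).
      { assert (E := Hb' x0 y0). fold b in E. lra. }
      split; [exact P|]. split; [exact P|]. split; [|left; split; reflexivity].
      apply Hcone; try exact P; left.
      - assert (E := Hb' (fst p) (snd p)). lra.
      - assert (E := Hb' (fst q) (snd q)). lra. }
    assert (a <> 0).
    { intros E. apply (Hq0 b); [lra|]. rewrite E in X1, X2. lra. }
    assert (b <> 0).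
    { intros E. apply (Hp0 a); [lra|]. rewrite E in X1, X2. lra. }
    exists (snd q / C), (- fst q / C), (- snd p / C), (fst p / C).
    assert (Pa : 0 < snd q / C * x0 + - fst q / C * y0) by (rewrite Ha; fold a; lra).
    assert (Pb : 0 < - snd p / C * x0 + fst p / C * y0) by (rewrite Hb'; fold b; lra).
    split; [exact Pa|]. split; [exact Pb|]. split.
    + apply Hcone; try assumption.
      * right. rewrite Hb', Hbp. lra.
      * left. rewrite Ha, Haq. lra.
    + right. destruct (Hcor HC) as (i & Hi & Ez & Ed). exists i.
      split; [exact Hi|]. split; [exact Ez|]. rewrite Ed; simpl.
      assert (E1 := Ha (fst p) (snd p)). assert (E2 := Ha (fst q) (snd q)).
      assert (E3 := Hb' (fst p) (snd p)). assert (E4 := Hb' (fst q) (snd q)). lra.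
Qed.

(** * The sweep over a triangle and the corner that first blocks it *)

Lemma lub_split (P : R -> Prop) (x0 M : R) :
  P x0 -> (forall x, P x -> x <= M) -> (forall x y, x0 <= x <= y -> P y -> P x) ->
  exists m, x0 <= m <= M /\ (forall x, x0 <= x < m -> P x) /\ (forall x, m < x -> ~ P x).
Proof.
  intros H0 HM Hdown. destruct (completeness P) as (m & Hub & Hl).
  - exists M. exact HM.
  - exists x0. exact H0.
  - exists m. split; [split; [apply Hub, H0|apply Hl; exact HM]|]. split.
    + intros x [Hx1 Hx2]. apply NNPP. intros Hn. apply (Rlt_not_le _ _ Hx2), Hl.
      intros y Hy. apply Rnot_lt_le. intros Hlt. apply Hn, (Hdown x y); [lra|exact Hy].
    + intros x Hx Px. apply Hub in Px. lra.
Qed.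

(** [t] is the infimum of the second parameters at which [f] occurs, and [s] the supremum of the
    first parameters up to which a strip beyond [t] is free of [f]. The point itself need not
    satisfy [f]; it is only a limit of points that do. *)
Lemma lexicographic_first (f : R -> R -> Prop) (s1 t1 : R) :
  0 <= s1 <= 1 -> 0 <= t1 < 1 -> f s1 t1 -> (forall t, 0 <= t <= 1 -> ~ f 0 t) ->
  exists s t, 0 <= s <= 1 /\ 0 <= t < 1 /\
    (forall s' t', 0 <= s' <= 1 -> 0 <= t' < t -> ~ f s' t') /\
    (forall s0, 0 <= s0 < s -> exists d, 0 < d /\ forall s' t',
       0 <= s' <= s0 -> 0 <= t' <= 1 -> t' < t + d -> ~ f s' t') /\
    (forall d, 0 < d -> exists s' t', 0 <= s' <= 1 /\ t <= t' < t + d /\ t' <= 1 /\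
       Rabs (s' - s) < d /\ f s' t').
Proof.
  intros Hs1 Ht1 Hf1 Hf0.
  destruct (lub_split (fun m => forall s t, 0 <= s <= 1 -> 0 <= t <= 1 -> f s t -> m <= t) 0 t1)
    as (t & Ht & Hlt & Hgt).
  { intros; lra. }
  { intros x Hx. apply (Hx s1 t1); try assumption; lra. }
  { intros x y Hxy Hy s t Hs Ht Hf. assert (H := Hy s t Hs Ht Hf). lra. }
  assert (HA : forall s' t', 0 <= s' <= 1 -> 0 <= t' < t -> ~ f s' t').
  { intros s' t' Hs' Ht' Hf.
    assert (H := Hlt ((t + t') / 2) ltac:(lra) s' t' Hs' ltac:(lra) Hf). lra. }
  destruct (lub_split (fun m => m <= 1 /\ exists d, 0 < d /\ forall s' t',
       0 <= s' <= m -> 0 <= t' <= 1 -> t' < t + d -> ~ f s' t') 0 1)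
    as (s & Hs & Hls & Hgs).
  { split; [lra|]. exists 1. split; [lra|]. intros s' t' Hs' Ht' _.
    replace s' with 0 by lra. apply Hf0; lra. }
  { intros x Hx; apply Hx. }
  { intros x y Hxy (Hy & d & Hd & H). split; [lra|]. exists d. split; [exact Hd|].
    intros s' t' Hs' Ht'. apply H; lra. }
  exists s, t. split; [exact Hs|]. split; [lra|]. split; [exact HA|]. split.
  { intros s0 Hs0. apply Hls, Hs0. }
  intros d Hd.
  assert (Hlow : exists d', 0 < d' <= d /\ forall s' t',
     0 <= s' <= s - d -> 0 <= t' <= 1 -> t' < t + d' -> ~ f s' t').
  { destruct (Rle_dec 0 (s - d)) as [H0|H0].
    - destruct (Hls (s - d) ltac:(lra)) as (_ & d' & Hd' & H).
      exists (Rmin d d'). assert (M1 := Rmin_l d d'). assert (M2 := Rmin_r d d').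
      split; [split; [apply Rmin_glb_lt; assumption|exact M1]|].
      intros s' t' Hs' Ht' Hlt'. apply H; lra.
    - exists d. split; [lra|]. intros; lra. }
  destruct Hlow as (d' & Hd' & Hlow).
  (* Otherwise a strip beyond [t] would be free up to a larger first parameter, contradicting the
     choice of [s], or, if [s = 1], across all of them, contradicting the choice of [t]. *)
  assert (Hex : exists s' t', 0 <= s' <= Rmin 1 (s + d / 2) /\ 0 <= t' <= 1 /\ t' < t + d' /\ f s' t').
  { apply NNPP. intros Hn.
    destruct (Rlt_dec s 1) as [Hs1'|Hs1'].
    - apply (Hgs (Rmin 1 (s + d / 2))); [apply Rmin_glb_lt; lra|].
      split; [apply Rmin_l|]. exists d'. split; [lra|].
      intros s' t' Hs' Ht' Htd Hf. apply Hn. exists s', t'. auto.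
    - apply (Hgt (t + d')); [lra|]. intros s' t' Hs' Ht' Hf. apply Rnot_lt_le.
      intros Hlt'. apply Hn. exists s', t'. rewrite Rmin_left by lra. auto. }
  destruct Hex as (s' & t' & Hs' & Ht' & Htd & Hf).
  assert (M1 := Rmin_l 1 (s + d / 2)). assert (M2 := Rmin_r 1 (s + d / 2)).
  exists s', t'. split; [lra|]. split; [split; [|lra]|].
  - apply Rnot_lt_le. intros H. apply (HA s' t'); try assumption; lra.
  - split; [lra|]. split; [|exact Hf]. apply Rabs_def1; [lra|].
    apply Rnot_le_lt. intros H. apply (Hlow s' t'); try assumption; lra.
Qed.

(** Here [x] is radial and [y] angular around the first blocked point. The exterior cone contains no
    [free] direction: none going back in angle, along the side [t = 0], or along the side [s = 1]. A
    direction of the cone with [y < 0] would yield one of these by convexity; openness then excludes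
    [y = 0]. *)
Lemma cone_above (free : R -> R -> Prop) (s t h1 h2 k1 k2 x0 y0 : R) :
  s <= 1 -> 0 <= t ->
  (forall x y, 0 < h1 * x + h2 * y -> 0 < k1 * x + k2 * y -> ~ free x y) ->
  (forall x y, 0 < t -> y < 0 -> s < 1 \/ x <= 0 -> free x y) ->
  (forall x, t = 0 -> s < 1 \/ x <= 0 -> free x 0) ->
  (forall y, s = 1 -> 0 < t \/ 0 <= y -> free 0 y) ->
  0 < h1 * x0 + h2 * y0 -> 0 < k1 * x0 + k2 * y0 ->
  0 <= y0 -> (s = 1 -> x0 <= 0) -> (t = 0 -> 0 < y0) ->
  forall x y, 0 < h1 * x + h2 * y -> 0 < k1 * x + k2 * y -> 0 < y.
Proof.
  intros Hs Ht Hdisj F1 F2 F3 Hh0 Hk0 Hy0 Hx0 Hy0t.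
  assert (comb : forall x y x' y' a b, 0 < a -> 0 <= b ->
     0 < h1 * x + h2 * y -> 0 < k1 * x + k2 * y ->
     0 < h1 * x' + h2 * y' -> 0 < k1 * x' + k2 * y' ->
     0 < h1 * (a * x + b * x') + h2 * (a * y + b * y') /\
     0 < k1 * (a * x + b * x') + k2 * (a * y + b * y')).
  { intros x y x' y' a b Ha Hb A1 A2 B1 B2.
    replace (h1 * _ + _) with (a * (h1 * x + h2 * y) + b * (h1 * x' + h2 * y')) by ring.
    replace (k1 * _ + _) with (a * (k1 * x + k2 * y) + b * (k1 * x' + k2 * y')) by ring.
    assert (0 < a * (h1 * x + h2 * y)) by (apply Rmult_lt_0_compat; lra).
    assert (0 < a * (k1 * x + k2 * y)) by (apply Rmult_lt_0_compat; lra).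
    assert (0 <= b * (h1 * x' + h2 * y')) by (apply Rmult_le_pos; lra).
    assert (0 <= b * (k1 * x' + k2 * y')) by (apply Rmult_le_pos; lra).
    lra. }
  assert (weak : forall x y, 0 < h1 * x + h2 * y -> 0 < k1 * x + k2 * y -> 0 <= y).
  { intros x y Hh Hk. apply Rnot_lt_le. intros Hy.
    destruct (Req_dec t 0) as [t0|t0].
    - assert (Py0 := Hy0t t0).
      (* The coefficients cancel the angular coordinate, giving a direction along the side
         [t = 0]. *)
      destruct (comb x y x0 y0 y0 (- y) Py0 ltac:(lra) Hh Hk Hh0 Hk0) as [Ch Ck].
      set (xc := y0 * x + - y * x0) in *.
      replace (y0 * y + - y * y0) with 0 in Ch, Ck by ring.
      destruct (Rlt_dec s 1) as [Hs1|Hs1].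
      { apply (Hdisj xc 0 Ch Ck), F2; auto. }
      destruct (Rle_dec xc 0) as [Hxc|Hxc].
      { apply (Hdisj xc 0 Ch Ck), F2; auto. }
      assert (s1 : s = 1) by lra. assert (Nx0 := Hx0 s1).
      (* These cancel the radial coordinate, giving a direction along the side [s = 1]. *)
      destruct (comb x0 y0 xc 0 xc (- x0) ltac:(lra) ltac:(lra) Hh0 Hk0 Ch Ck) as [Dh Dk].
      replace (xc * x0 + - x0 * xc) with 0 in Dh, Dk by ring.
      apply (Hdisj _ _ Dh Dk), F3; [exact s1|right]. nra.
    - destruct (Rlt_dec s 1) as [Hs1|Hs1].
      { apply (Hdisj x y Hh Hk), F1; auto; lra. }
      destruct (Rle_dec x 0) as [Hx|Hx].
      { apply (Hdisj x y Hh Hk), F1; auto; lra. }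
      assert (s1 : s = 1) by lra. assert (Nx0 := Hx0 s1).
      destruct (comb x0 y0 x y x (- x0) ltac:(lra) ltac:(lra) Hh0 Hk0 Hh Hk) as [Dh Dk].
      replace (x * x0 + - x0 * x) with 0 in Dh, Dk by ring.
      apply (Hdisj _ _ Dh Dk), F3; [exact s1|left; lra]. }
  intros x y Hh Hk. destruct (weak x y Hh Hk) as [|E]; [assumption|exfalso].
  (* The cone is open: lowering a point with [y = 0] by a small [e] would stay in it, against
     [weak]. *)
  pose (m := Rmin (h1 * x + h2 * y) (k1 * x + k2 * y)).
  assert (Hm : 0 < m) by (apply Rmin_glb_lt; assumption).
  assert (M1 : m <= h1 * x + h2 * y) by apply Rmin_l.
  assert (M2 : m <= k1 * x + k2 * y) by apply Rmin_r.
  assert (A1 := Rle_abs h2). assert (A2 := Rle_abs k2).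
  assert (P1 := Rabs_pos h2). assert (P2 := Rabs_pos k2).
  pose (e := m / (Rabs h2 + Rabs k2 + 1)).
  assert (He : 0 < e) by (apply Rdiv_lt_0_compat; lra).
  assert (Ee : e * (Rabs h2 + Rabs k2 + 1) = m) by (unfold e; field; lra).
  clearbody e m.
  assert (H := weak x (y - e) ltac:(nra) ltac:(nra)). lra.
Qed.

(** On the common line put [a] at 0, [w] at 1 and [g] at [l]. Every point between [a] and [g] then
    lies between [a] and [w] or between [g] and [w]. *)
Lemma covers_collinear (n : nat) (v : nat -> point) (a w g : point) :
  covers n v a w -> covers n v g w -> cross (vec a w) (vec a g) = 0 -> covers n v g a.
Proof.
  destruct a as [a1 a2], w as [w1 w2], g as [g1 g2].
  unfold covers, cross, vec, lerp; simpl. intros Haw Hgw Hc.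
  destruct (classic (w1 - a1 <> 0 \/ w2 - a2 <> 0)) as [Hne|He].
  2:{ assert (E1 : a1 = w1) by (apply NNPP; intros H; apply He; left; lra).
      assert (E2 : a2 = w2) by (apply NNPP; intros H; apply He; right; lra).
      rewrite E1, E2. exact Hgw. }
  apply sqr_sum_pos in Hne.
  set (N := _ + _) in Hne.
  pose (l := ((w1 - a1) * (g1 - a1) + (w2 - a2) * (g2 - a2)) / N).
  assert (G1 : g1 = a1 + l * (w1 - a1)).
  { apply (Rmult_eq_reg_r N); [|lra]. unfold l.
    transitivity (a1 * N + ((w1 - a1) * (g1 - a1) + (w2 - a2) * (g2 - a2)) * (w1 - a1));
      [|field; lra].
    transitivity (a1 * N + ((w1 - a1) * (g1 - a1) + (w2 - a2) * (g2 - a2)) * (w1 - a1)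
      - ((w1 - a1) * (g2 - a2) - (w2 - a2) * (g1 - a1)) * (w2 - a2));
      [unfold N; ring|rewrite Hc; ring]. }
  assert (G2 : g2 = a2 + l * (w2 - a2)).
  { apply (Rmult_eq_reg_r N); [|lra]. unfold l.
    transitivity (a2 * N + ((w1 - a1) * (g1 - a1) + (w2 - a2) * (g2 - a2)) * (w2 - a2));
      [|field; lra].
    transitivity (a2 * N + ((w1 - a1) * (g1 - a1) + (w2 - a2) * (g2 - a2)) * (w2 - a2)
      + ((w1 - a1) * (g2 - a2) - (w2 - a2) * (g1 - a1)) * (w1 - a1));
      [unfold N; ring|rewrite Hc; ring]. }
  clearbody l. clear Hc Hne N. subst g1 g2. intros t Ht.
  (* [m] is the position, on this scale, of the point at time [t] from [g] to [a]. *)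
  pose (m := (1 - t) * l).
  assert (onaw : 0 <= m <= 1 -> gallery n v
    ((1 - t) * (a1 + l * (w1 - a1)) + t * a1, (1 - t) * (a2 + l * (w2 - a2)) + t * a2)).
  { intros Hm. replace (_, _) with ((1 - m) * a1 + m * w1, (1 - m) * a2 + m * w2)
      by (unfold m; apply point_eq; simpl; ring).
    apply Haw, Hm. }
  assert (ongw : l <> 1 -> 0 <= (l - m) / (l - 1) <= 1 -> gallery n v
    ((1 - t) * (a1 + l * (w1 - a1)) + t * a1, (1 - t) * (a2 + l * (w2 - a2)) + t * a2)).
  { intros Hl Hm. assert (H := Hgw _ Hm).
    match goal with |- gallery _ _ ?p => match type of H with gallery _ _ ?q =>
      replace p with q; [exact H|] end end.
    unfold m; apply point_eq; simpl; field; lra. }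
  destruct (Rle_dec 0 l) as [L0|L0].
  - destruct (Rle_dec m 1) as [M1|M1].
    + apply onaw. split; [apply Rmult_le_pos; lra|exact M1].
    + assert (Hml : m <= l) by (unfold m; nra).
      apply ongw; [lra|]. split; [apply Rle_mult_inv_pos; lra|].
      apply (Rmult_le_reg_r (l - 1)); [lra|]. unfold Rdiv.
      rewrite Rmult_assoc, Rinv_l; lra.
  - assert (Hml : l <= m <= 0) by (unfold m; nra).
    apply ongw; [lra|].
    replace ((l - m) / (l - 1)) with ((m - l) / (1 - l)) by (field; lra).
    split; [apply Rle_mult_inv_pos; lra|].
    apply (Rmult_le_reg_r (1 - l)); [lra|]. unfold Rdiv.
    rewrite Rmult_assoc, Rinv_l; lra.
Qed.

Lemma small_comb (r a1 a2 b1 b2 : R) : 0 < r -> exists d, 0 < d /\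
  forall x y, Rabs x < d -> Rabs y < d ->
    Rabs (x * a1 + y * b1) < r /\ Rabs (x * a2 + y * b2) < r.
Proof.
  intros Hr.
  assert (P1 := Rabs_pos a1). assert (P2 := Rabs_pos a2).
  assert (P3 := Rabs_pos b1). assert (P4 := Rabs_pos b2).
  set (L := Rabs a1 + Rabs a2 + Rabs b1 + Rabs b2 + 1).
  assert (HL : 0 < L) by (unfold L; lra).
  exists (r / L). assert (Hd : 0 < r / L) by (apply Rdiv_lt_0_compat; lra).
  split; [exact Hd|]. intros x y Hx Hy.
  assert (Ed : r / L * L = r) by (field; lra). set (d := r / L) in *. clearbody d.
  assert (aux : forall c e, Rabs c + Rabs e + 1 <= L -> Rabs (x * c + y * e) < r).
  { intros c e H. apply Rle_lt_trans with (1 := Rabs_triang _ _).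
    rewrite 2!Rabs_mult. assert (0 <= Rabs c) by apply Rabs_pos.
    assert (0 <= Rabs e) by apply Rabs_pos.
    assert (Rabs x * Rabs c <= d * Rabs c) by (apply Rmult_le_compat_r; lra).
    assert (Rabs y * Rabs e <= d * Rabs e) by (apply Rmult_le_compat_r; lra).
    assert (d * (Rabs c + Rabs e + 1) <= d * L) by (apply Rmult_le_compat_l; lra).
    lra. }
  split; apply aux; unfold L; lra.
Qed.

(* In the triangle with apex [a], [off z (x * a' + y * b')] is the point with
   radial parameter [s + x] and angular parameter [t + y / (s + x)]. *)
Lemma triangle_params (s t x y : R) :
  0 < s <= 1 -> 0 <= t < 1 -> s < 1 \/ x <= 0 -> 0 < t \/ 0 <= y ->
  exists e0, 0 < e0 /\ forall e, 0 < e < e0 ->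
    0 < s + e * x <= 1 /\ 0 <= t + e * y / (s + e * x) <= 1.
Proof.
  intros Hs Ht Hx Hy.
  (* [m] will bound the changes [e * x] and [e * y]. The bounds keep, in this order, the radius at
     least [s / 2], the angular parameter at most 1, the radius at most 1, and the angular parameter
     nonnegative. *)
  assert (Hm : exists m, 0 < m /\ m <= s / 2 /\ m <= (1 - t) * (s / 2) /\
     (s < 1 -> m <= 1 - s) /\ (0 < t -> m <= t * (s / 2))).
  { pose (u := if Rlt_dec s 1 then 1 - s else 1).
    pose (w := if Rlt_dec 0 t then t * (s / 2) else 1).
    assert (Hu : 0 < u) by (unfold u; destruct (Rlt_dec s 1); lra).
    assert (Hw : 0 < w).
    { unfold w; destruct (Rlt_dec 0 t); [|lra]. apply Rmult_lt_0_compat; lra. }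
    assert (Hv : 0 < (1 - t) * (s / 2)) by (apply Rmult_lt_0_compat; lra).
    exists (Rmin (Rmin (s / 2) ((1 - t) * (s / 2))) (Rmin u w)).
    assert (N1 := Rmin_l (s / 2) ((1 - t) * (s / 2))).
    assert (N2 := Rmin_r (s / 2) ((1 - t) * (s / 2))).
    assert (N3 := Rmin_l u w). assert (N4 := Rmin_r u w).
    assert (N5 := Rmin_l (Rmin (s / 2) ((1 - t) * (s / 2))) (Rmin u w)).
    assert (N6 := Rmin_r (Rmin (s / 2) ((1 - t) * (s / 2))) (Rmin u w)).
    split; [repeat apply Rmin_glb_lt; lra|].
    split; [lra|]. split; [lra|]. split; intros H.
    - unfold u in *. destruct (Rlt_dec s 1); lra.
    - unfold w in *. destruct (Rlt_dec 0 t); lra. }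
  destruct Hm as (m & Hm & M1 & M2 & M3 & M4).
  assert (Px := Rabs_pos x). assert (Py := Rabs_pos y).
  exists (m / (Rabs x + Rabs y + 1)). split; [apply Rdiv_lt_0_compat; lra|].
  intros e He. set (e0 := m / _) in *.
  assert (Ee : e0 * (Rabs x + Rabs y + 1) = m) by (unfold e0; field; lra). clearbody e0.
  assert (Sm : forall c, Rabs c <= Rabs x + Rabs y -> - m <= e * c <= m).
  { intros c Hc. assert (Pc := Rabs_pos c).
    assert (H : Rabs (e * c) <= m).
    { rewrite Rabs_mult, (Rabs_pos_eq e) by lra.
      apply Rle_trans with (e0 * Rabs c); [apply Rmult_le_compat_r; lra|].
      rewrite <- Ee. apply Rmult_le_compat_l; lra. }
    assert (A := Rle_abs (e * c)). assert (B := Rle_abs (- (e * c))).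
    rewrite Rabs_Ropp in B. lra. }
  assert (Sx := Sm x ltac:(lra)). assert (Sy := Sm y ltac:(lra)).
  assert (Q0 : s / 2 <= s + e * x) by lra.
  split.
  { split; [lra|]. destruct Hx as [Hx|Hx]; [assert (H := M3 Hx); lra|].
    assert (e * x <= 0) by nra. lra. }
  set (q := s + e * x) in *. assert (Pq : 0 < q) by lra.
  assert (Eq : (t + e * y / q) * q = t * q + e * y) by (field; lra).
  assert (T1 : 0 <= t * q) by (apply Rmult_le_pos; lra).
  assert (T2 : (1 - t) * (s / 2) <= (1 - t) * q) by (apply Rmult_le_compat_l; lra).
  assert (T3 : t * (s / 2) <= t * q) by (apply Rmult_le_compat_l; lra).
  split; apply (Rmult_le_reg_r q); try exact Pq; rewrite Eq.
  - destruct Hy as [Hy|Hy]; [assert (H := M4 Hy); lra|].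
    assert (0 <= e * y) by (apply Rmult_le_pos; lra). lra.
  - lra.
Qed.

Lemma reflex_of_exterior_dir (n : nat) (v : nat -> point) (i : nat) (r h1 h2 k1 k2 : R) :
  0 < r ->
  (forall x y, Rabs x < r -> Rabs y < r ->
     0 < h1 * x + h2 * y -> 0 < k1 * x + k2 * y -> ~ gallery n v (off (v i) x y)) ->
  0 < h1 * fst (corner_dir n v i) + h2 * snd (corner_dir n v i) ->
  0 < k1 * fst (corner_dir n v i) + k2 * snd (corner_dir n v i) ->
  reflex n v i.
Proof.
  intros Hr Hext Hh Hk.
  destruct (small_comb r (fst (corner_dir n v i)) (snd (corner_dir n v i)) 0 0 Hr)
    as (d & Hd & Hsm).
  exists d. split; [exact Hd|]. intros s Hs.
  assert (As : Rabs s < d) by (rewrite Rabs_pos_eq; lra).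
  destruct (Hsm s 0 As ltac:(rewrite Rabs_R0; exact Hd)) as [H1 H2].
  rewrite Rmult_0_r, Rplus_0_r in H1, H2.
  apply (Hext _ _ H1 H2).
  - replace (_ + _) with
      (s * (h1 * fst (corner_dir n v i) + h2 * snd (corner_dir n v i))) by ring.
    apply Rmult_lt_0_compat; lra.
  - replace (_ + _) with
      (s * (k1 * fst (corner_dir n v i) + k2 * snd (corner_dir n v i))) by ring.
    apply Rmult_lt_0_compat; lra.
Qed.

(* In the first direction that meets the exterior, the limit of exterior points
   nearest to [a] is the corner. *)
Lemma blocking_corner (n : nat) (v : nat -> point) (a w g : point) :
  simple_polygon n v -> gallery n v a -> ~ on_boundary n v a ->
  covers n v a w -> covers n v g w -> ~ covers n v g a ->
  exists i, (i < n)%nat /\ reflex n v i /\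
    let r := vec a (v i) in
    let c := cross r (corner_dir n v i) in
    0 < c * cross r (vec a g) /\
    (c * cross r (vec a w) < 0 \/ cross r (vec a w) = 0 /\ 0 < dot r (vec a w)).
Proof.
  intros Hs Ha Hab Haw Hgw Hga.
  set (K := cross (vec a w) (vec a g)).
  assert (HK : K <> 0) by (intros H; apply Hga, (covers_collinear n v a w g Haw Hgw H)).
  set (w1 := fst (vec a w)) in *. set (w2 := snd (vec a w)) in *.
  set (g1 := fst (vec a g)) in *. set (g2 := snd (vec a g)) in *.
  (* [X s t] is at fraction [s] of the way from [a] to the point at fraction [t] from [w] to [g].
     The sides [t = 0] and [s = 1] are in the gallery. *)
  pose (X := fun s t => off a (s * ((1 - t) * w1 + t * g1)) (s * ((1 - t) * w2 + t * g2))).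
  assert (Xa : forall t, X 0 t = a) by (intros; apply point_eq; simpl; ring).
  assert (Xw : forall s, 0 <= s <= 1 -> gallery n v (X s 0)).
  { intros s H. replace (X s 0) with (lerp a w s); [apply Haw, H|].
    apply point_eq; unfold X, w1, w2, g1, g2; simpl; ring. }
  assert (Xg : forall t, 0 <= t <= 1 -> gallery n v (X 1 t)).
  { intros t H. replace (X 1 t) with (lerp g w (1 - t)); [apply Hgw; lra|].
    apply point_eq; unfold X, w1, w2, g1, g2; simpl; ring. }
  (* The segment from [g] to [a] is the side [t = 1]; as the exterior is open, an exterior point on
     it can be moved to some [t < 1]. *)
  assert (Hex : exists s t, 0 <= s <= 1 /\ 0 <= t < 1 /\ ~ gallery n v (X s t)).
  { apply not_all_ex_not in Hga as (t & Hga). apply imply_to_and in Hga as [Ht Hga].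
    destruct (exterior_open n v _ Hs Hga) as (r & Hr & H).
    destruct (small_comb r ((1 - t) * (w1 - g1)) ((1 - t) * (w2 - g2)) 0 0 Hr) as (d & Hd & Hsm).
    pose (e := Rmin (d / 2) (1 / 2)).
    assert (He : 0 < e) by (apply Rmin_glb_lt; lra).
    assert (M1 : e <= d / 2) by apply Rmin_l. assert (M2 : e <= 1 / 2) by apply Rmin_r.
    exists (1 - t), (1 - e). split; [lra|]. split; [lra|].
    destruct (Hsm e 0) as [B1 B2];
      [rewrite Rabs_pos_eq; lra|rewrite Rabs_R0; exact Hd|].
    rewrite Rmult_0_r, Rplus_0_r in B1, B2.
    assert (H' := H _ _ B1 B2).
    match type of H' with ~ gallery _ _ ?p => replace (X (1 - t) (1 - e)) with p; [exact H'|] end.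
    apply point_eq; unfold X, w1, w2, g1, g2; simpl; ring. }
  destruct Hex as (s1 & t1 & Hs1 & Ht1 & Hf1).
  destruct (lexicographic_first (fun s t => ~ gallery n v (X s t)) s1 t1 Hs1 Ht1 Hf1)
    as (s & t & Hs01 & Ht01 & HA & HB & HC).
  { intros t _ H. apply H. rewrite Xa. exact Ha. }
  (* Local coordinates at [z]: a radial unit [(a1, a2)] along the blocked ray and an angular unit
     [(b1, b2)] from [w] to [g]. *)
  set (a1 := (1 - t) * w1 + t * g1). set (a2 := (1 - t) * w2 + t * g2).
  set (b1 := g1 - w1). set (b2 := g2 - w2).
  set (z := X s t).
  assert (Xz : forall s' t', X s' t' =
     off z ((s' - s) * a1 + s' * (t' - t) * b1) ((s' - s) * a2 + s' * (t' - t) * b2)).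
  { intros. apply point_eq; unfold z, X, a1, a2, b1, b2; simpl; ring. }
  assert (near : forall r, 0 < r -> exists s' t', 0 <= s' <= 1 /\ t <= t' <= 1 /\
     let x := s' - s in let y := s' * (t' - t) in
     Rabs (x * a1 + y * b1) < r /\ Rabs (x * a2 + y * b2) < r /\ ~ gallery n v (X s' t')).
  { intros r Hr. destruct (small_comb r a1 a2 b1 b2 Hr) as (d & Hd & Hsm).
    destruct (HC d Hd) as (s' & t' & Hs' & Ht' & Ht'1 & Hd' & Hf).
    exists s', t'. split; [exact Hs'|]. split; [lra|]. cbv zeta.
    destruct (Hsm (s' - s) (s' * (t' - t)) Hd') as [B1 B2].
    { rewrite Rabs_pos_eq by (apply Rmult_le_pos; lra). nra. }
    auto. }
  (* Gallery points arbitrarily near [z], slightly closer to [a] and slightly past the blocked ray;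
     they come from the choice of [s]. *)
  assert (before : forall r, 0 < s -> 0 < r -> exists x y, x < 0 /\ 0 < y /\
     Rabs (x * a1 + y * b1) < r /\ Rabs (x * a2 + y * b2) < r /\
     gallery n v (off z (x * a1 + y * b1) (x * a2 + y * b2))).
  { intros r Ps Hr. destruct (small_comb r a1 a2 b1 b2 Hr) as (d & Hd & Hsm).
    pose (e := Rmin (s / 2) (d / 2)).
    assert (He : 0 < e) by (apply Rmin_glb_lt; lra).
    assert (M1 : e <= s / 2) by apply Rmin_l. assert (M2 : e <= d / 2) by apply Rmin_r.
    clearbody e.
    destruct (HB (s - e) ltac:(lra)) as (d' & Hd' & H).
    pose (u := Rmin (Rmin (1 - t) (d' / 2)) (d / 2)).
    assert (Hu : 0 < u) by (repeat apply Rmin_glb_lt; lra).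
    assert (U1 : u <= Rmin (1 - t) (d' / 2)) by apply Rmin_l.
    assert (U2 : u <= d / 2) by apply Rmin_r.
    assert (U3 := Rmin_l (1 - t) (d' / 2)). assert (U4 := Rmin_r (1 - t) (d' / 2)).
    clearbody u.
    exists (- e), ((s - e) * u).
    assert (Py : 0 < (s - e) * u) by (apply Rmult_lt_0_compat; lra).
    split; [lra|]. split; [exact Py|].
    destruct (Hsm (- e) ((s - e) * u)) as [B1 B2].
    { rewrite Rabs_Ropp, Rabs_pos_eq; lra. }
    { rewrite Rabs_pos_eq by lra. nra. }
    split; [exact B1|]. split; [exact B2|].
    apply NNPP. intros Hn. apply (H (s - e) (t + u)); try lra.
    rewrite Xz. replace (s - e - s) with (- e) by ring. replace (t + u - t) with u by ring.
    exact Hn. }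
  (* Exterior points accumulate at [z], and so do gallery points: those of [before], or [a] itself
     if [s = 0]. *)
  assert (zbd : on_boundary n v z).
  { apply NNPP. intros Hz. destruct (off_boundary_open n v z Hs Hz) as (r & Hr & Hbox).
    destruct (near r Hr) as (s' & t' & _ & _ & B1 & B2 & Hf). rewrite Xz in Hf.
    destruct (Req_dec s 0) as [s0|s0].
    - assert (R0 : Rabs 0 < r) by (rewrite Rabs_R0; exact Hr).
      apply (exterior_box n v z r _ _ 0 0 Hbox B1 B2 R0 R0 Hf).
      replace (off z 0 0) with a; [exact Ha|].
      unfold z. rewrite s0, Xa. apply point_eq; simpl; ring.
    - destruct (before r ltac:(lra) Hr) as (x & y & _ & _ & B3 & B4 & Hin).
      exact (exterior_box n v z r _ _ _ _ Hbox B1 B2 B3 B4 Hf Hin). }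
  assert (Ps : 0 < s).
  { destruct (Req_dec s 0) as [s0|s0]; [|lra]. exfalso. apply Hab.
    rewrite <- (Xa t), <- s0. exact zbd. }
  destruct (exterior_convex_cone n v z Hs zbd) as (r & Hr & Hcone).
  destruct (near r Hr) as (s0 & t0 & Hs0 & Ht0 & B1 & B2 & Hf).
  assert (Hf' := Hf). rewrite Xz in Hf'.
  destruct (Hcone _ _ B1 B2 Hf') as (h1 & h2 & k1 & k2 & Hh0 & Hk0 & Hext & Hcase).
  clear Hcone.
  pose (free := fun x y => exists e0, 0 < e0 /\ forall e, 0 < e < e0 ->
     gallery n v (off z (e * x * a1 + e * y * b1) (e * x * a2 + e * y * b2))).
  assert (Hdisj : forall x y, 0 < (h1 * a1 + h2 * a2) * x + (h1 * b1 + h2 * b2) * y ->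
     0 < (k1 * a1 + k2 * a2) * x + (k1 * b1 + k2 * b2) * y -> ~ free x y).
  { intros x y Hh Hk (e0 & He0 & Hfree).
    destruct (small_comb r (x * a1 + y * b1) (x * a2 + y * b2) 0 0 Hr) as (d & Hd & Hsm).
    pose (e := Rmin (e0 / 2) (d / 2)).
    assert (He : 0 < e) by (apply Rmin_glb_lt; lra).
    assert (M1 : e <= e0 / 2) by apply Rmin_l. assert (M2 : e <= d / 2) by apply Rmin_r.
    clearbody e.
    destruct (Hsm e 0) as [D1 D2];
      [rewrite Rabs_pos_eq; lra|rewrite Rabs_R0; exact Hd|].
    replace (e * (x * a1 + y * b1) + 0 * 0) with (e * x * a1 + e * y * b1) in D1 by ring.
    replace (e * (x * a2 + y * b2) + 0 * 0) with (e * x * a2 + e * y * b2) in D2 by ring.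
    apply (Hext _ _ D1 D2); [| |apply Hfree; lra].
    - replace (_ + _) with (e * ((h1 * a1 + h2 * a2) * x + (h1 * b1 + h2 * b2) * y)) by ring.
      apply Rmult_lt_0_compat; lra.
    - replace (_ + _) with (e * ((k1 * a1 + k2 * a2) * x + (k1 * b1 + k2 * b2) * y)) by ring.
      apply Rmult_lt_0_compat; lra. }
  assert (Hfree : forall x y, s < 1 \/ x <= 0 -> 0 < t \/ 0 <= y ->
     (forall e, 0 < e -> 0 < s + e * x <= 1 -> 0 <= t + e * y / (s + e * x) <= 1 ->
        gallery n v (X (s + e * x) (t + e * y / (s + e * x)))) -> free x y).
  { intros x y Hx Hy H.
    destruct (triangle_params s t x y ltac:(lra) Ht01 Hx Hy) as (e0 & He0 & Hp).
    exists e0. split; [exact He0|]. intros e He. destruct (Hp e He) as [P1 P2].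
    assert (H' := H e ltac:(lra) P1 P2). rewrite Xz in H'.
    replace (s + e * x - s) with (e * x) in H' by ring.
    replace ((s + e * x) * (t + e * y / (s + e * x) - t)) with (e * y) in H' by (field; lra).
    exact H'. }
  (* The cone contains the offset of a nearby exterior point. Smaller angles are free by minimality
     of [t], the side [t = 0] because [a] sees [w], and the side [s = 1] because [g] sees [w]. *)
  assert (Habove := cone_above free s t _ _ _ _ (s0 - s) (s0 * (t0 - t))
    ltac:(lra) ltac:(lra) Hdisj).
  assert (above : forall x y, 0 < (h1 * a1 + h2 * a2) * x + (h1 * b1 + h2 * b2) * y ->
     0 < (k1 * a1 + k2 * a2) * x + (k1 * b1 + k2 * b2) * y -> 0 < y).
  { apply Habove; clear Habove.
    - intros x y Pt Ny Hx. apply Hfree; auto. intros e He P1 P2.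
      apply NNPP. apply HA; [lra|]. split; [lra|].
      assert (e * y / (s + e * x) < 0); [|lra].
      apply Rmult_lt_reg_r with (s + e * x); [lra|].
      unfold Rdiv. rewrite Rmult_assoc, Rinv_l by lra. nra.
    - intros x Et Hx. apply Hfree; auto; [right; lra|]. intros e He P1 P2.
      replace (t + e * 0 / (s + e * x)) with 0 by (rewrite Et; field; lra).
      apply Xw; lra.
    - intros y Es Hy. apply Hfree; auto; [right; lra|]. intros e He P1 P2.
      replace (s + e * 0) with 1 in * by lra. apply Xg; lra.
    - eapply Rlt_le_trans; [exact Hh0|]. apply Req_le; ring.
    - eapply Rlt_le_trans; [exact Hk0|]. apply Req_le; ring.
    - apply Rmult_le_pos; lra.
    - intros; lra.
    - intros Et. apply Rmult_lt_0_compat.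
      + apply Rnot_le_lt. intros H. apply Hf. replace s0 with 0 by lra. rewrite Xa. exact Ha.
      + apply Rnot_le_lt. intros H. apply Hf. replace t0 with 0 by lra. apply Xw, Hs0. }
  clear Habove Hfree Hdisj free.
  assert (K1 : a1 * b2 - a2 * b1 = K).
  { unfold K, cross. fold w1 w2 g1 g2. unfold a1, a2, b1, b2. ring. }
  destruct Hcase as [[-> ->]|(i & Hi & Ez & Hhd & Hkd)].
  (* An exterior half plane contained in [0 < y] equals it and would contain the gallery points of
     [before]. So [z] is a reflex corner. *)
  - exfalso.
    set (m := k1 * a1 + k2 * a2) in *. set (m' := k1 * b1 + k2 * b2) in *.
    assert (m0 : m = 0).
    { apply NNPP. intros Hm.
      assert (H := above ((1 + m') / m) (-1)).
      replace (m * ((1 + m') / m) + m' * -1) with 1 in H by (field; exact Hm). lra. }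
    assert (Hm' : 0 < m').
    { apply Rnot_le_lt. intros H. destruct (Req_dec m' 0) as [E|E].
      - assert (Hk : (s0 - s) * m + s0 * (t0 - t) * m' = 0) by (rewrite m0, E; ring).
        assert (H0 := Hk0). unfold m, m' in Hk. lra.
      - assert (H1 := above 0 (-1)). lra. }
    destruct (before r Ps Hr) as (x & y & Hx & Hy & D1 & D2 & Hin).
    assert (Pos : 0 < k1 * (x * a1 + y * b1) + k2 * (x * a2 + y * b2)).
    { replace (_ + _) with (x * m + y * m') by (unfold m, m'; ring).
      rewrite m0. nra. }
    exact (Hext _ _ D1 D2 Pos Pos Hin).
  - exists i. split; [exact Hi|]. split.
    { rewrite Ez in Hext.
      exact (reflex_of_exterior_dir n v i r h1 h2 k1 k2 Hr Hext Hhd Hkd). }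
    set (d1 := fst (corner_dir n v i)) in *. set (d2 := snd (corner_dir n v i)) in *.
    (* By Cramer's rule this is the angular coordinate of [corner_dir]; [K] is the determinant of
       the local basis. *)
    assert (Py : 0 < (a1 * d2 - a2 * d1) / K).
    { apply (above ((d1 * b2 - d2 * b1) / K)).
      - eapply Rlt_le_trans; [exact Hhd|]. apply Req_le. rewrite <- K1. field.
        rewrite K1. exact HK.
      - eapply Rlt_le_trans; [exact Hkd|]. apply Req_le. rewrite <- K1. field.
        rewrite K1. exact HK. }
    set (y := (a1 * d2 - a2 * d1) / K) in *.
    assert (Ey : a1 * d2 - a2 * d1 = y * K) by (unfold y; field; exact HK).
    clearbody y.
    assert (V1 : fst (vec a (v i)) = s * a1).
    { rewrite <- Ez. unfold z, X, a1; simpl; ring. }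
    assert (V2 : snd (vec a (v i)) = s * a2).
    { rewrite <- Ez. unfold z, X, a2; simpl; ring. }
    (* The three cross products become [s * y * K], [s * (1 - t) * K] and [- (s * t * K)], so the
       sign of [K], the orientation of the triangle, cancels in the products. *)
    cbv zeta. unfold cross, dot. rewrite V1, V2. fold w1 w2 g1 g2 d1 d2.
    replace (s * a1 * d2 - s * a2 * d1) with (s * y * K)
      by (replace (s * y * K) with (s * (y * K)) by ring; rewrite <- Ey; ring).
    assert (C1 : s * a1 * g2 - s * a2 * g1 = s * (1 - t) * K)
      by (unfold K, cross; fold w1 w2 g1 g2; unfold a1, a2; ring).
    assert (C2 : s * a1 * w2 - s * a2 * w1 = - (s * t * K))
      by (unfold K, cross; fold w1 w2 g1 g2; unfold a1, a2; ring).
    rewrite C1, C2.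
    assert (KK : 0 < K * K) by (apply Rsqr_pos_lt in HK; exact HK).
    assert (sy : 0 < s * s * y) by (repeat apply Rmult_lt_0_compat; assumption).
    assert (syK : 0 < s * s * y * (K * K)) by (apply Rmult_lt_0_compat; assumption).
    split.
    + replace (_ * _) with ((1 - t) * (s * s * y * (K * K))) by ring.
      apply Rmult_lt_0_compat; lra.
    (* For [t = 0] the corner lies on the segment from [a] to [w]. *)
    + destruct (Req_dec t 0) as [Et|Et].
      * right. split; [rewrite Et; ring|].
        replace (_ + _) with (s * (w1 * w1 + w2 * w2))
          by (unfold a1, a2; rewrite Et; ring).
        apply Rmult_lt_0_compat; [exact Ps|]. apply sqr_sum_pos.
        apply NNPP. intros H. apply HK. unfold K, cross. fold w1 w2 g1 g2.
        destruct (Req_dec w1 0) as [E1|]; [|tauto].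
        destruct (Req_dec w2 0) as [E2|]; [|tauto].
        rewrite E1, E2. ring.
      * left. replace (_ * _) with (- (t * (s * s * y * (K * K)))) by ring.
        assert (0 < t * (s * s * y * (K * K))) by (apply Rmult_lt_0_compat; lra). lra.
Qed.

(** * Ends of rays from [a], and limits of visible points *)

(** The ray must leave the box that bounds the component of [a], hence meets a wall, and [a] sees
    the first wall point. [K] is chosen before [u], so that a family of tilted rays has uniformly
    bounded lengths. *)
Lemma ray_hit (n : nat) (v : nat -> point) (a : point) :
  simple_polygon n v -> ~ on_boundary n v a -> in_bounded_component n v a ->
  exists K, 0 <= K /\ forall u, 0 < dot u u ->
    exists t, 0 < t <= K / dot u u + 1 /\
      on_boundary n v (off a (t * fst u) (t * snd u)) /\
      covers n v a (off a (t * fst u) (t * snd u)).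
Proof.
  intros Hs Hab Hin. assert (Hin' := Hin). destruct Hin' as [M HM].
  pose (B := Rabs M + Rabs (fst a) + Rabs (snd a)).
  (* While the ray avoids the walls, each coordinate of its displacement is at most [B] in absolute
     value, so [s * s * N <= 2 * (B * B)]; the added 1 covers [s <= 1]. *)
  exists (2 * (B * B)). split; [assert (H := Rle_0_sqr B); unfold Rsqr in H; lra|].
  intros u Hu. set (N := dot u u) in *.
  set (ray := fun s => off a (s * fst u) (s * snd u)).
  assert (ray0 : ray 0 = a) by (apply point_eq; simpl; ring).
  assert (Hbound : forall s, 0 <= s -> (forall s', 0 <= s' <= s -> ~ on_boundary n v (ray s')) ->
     s <= 2 * (B * B) / N + 1).
  { intros s Hs0 Hfree.
    assert (H := HM (fun x => fst a + x * s * fst u) (fun x => snd a + x * s * snd u)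
      ltac:(reg) ltac:(reg) ltac:(cbv beta; ring) ltac:(cbv beta; ring)).
    cbv beta in H. destruct (H) with (t := 1) as [H1 H2]; [|lra|].
    { intros t Ht. apply (Hfree (t * s)). split; nra. }
    clear H. rewrite Rmult_1_l in H1, H2.
    assert (Sq : forall c x, Rabs c <= Rabs (fst a) + Rabs (snd a) -> Rabs (c + x) <= M ->
       x * x <= B * B).
    { intros c x Hc Hx.
      assert (A1 := Rle_abs M). assert (A2 := Rabs_triang (c + x) (- c)).
      rewrite Rabs_Ropp in A2. replace (c + x + - c) with x in A2 by ring.
      assert (A3 : Rabs x <= Rabs B).
      { apply Rle_trans with (2 := Rle_abs B). unfold B. lra. }
      apply Rsqr_le_abs_1 in A3. exact A3. }
    assert (P1 := Rabs_pos (fst a)). assert (P2 := Rabs_pos (snd a)).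
    assert (S1 := Sq (fst a) _ ltac:(lra) H1). assert (S2 := Sq (snd a) _ ltac:(lra) H2).
    assert (S3 : s * s * N <= 2 * (B * B)) by (unfold N, dot; lra).
    apply (Rmult_le_reg_r N); [exact Hu|].
    replace ((2 * (B * B) / N + 1) * N) with (2 * (B * B) + N) by (field; lra).
    destruct (Rle_dec s 1) as [Hs1|Hs1].
    - assert (0 <= B * B) by apply (Rle_0_sqr B). nra.
    - assert (s * N <= s * s * N); [|lra].
      apply Rmult_le_compat_r; [lra|]. nra. }
  destruct (lub_split (fun s => forall s', 0 <= s' <= s -> ~ on_boundary n v (ray s'))
     0 (2 * (B * B) / N + 1)) as (t & Ht & Hlt & Hgt).
  { intros s' Hs'. replace s' with 0 by lra. rewrite ray0. exact Hab. }
  { intros x Hx. destruct (Rle_dec 0 x) as [H|H]; [apply Hbound; assumption|].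
    assert (H0 := Hbound 0 ltac:(lra)). apply Rle_trans with 0; [lra|]. apply H0.
    intros s' Hs'. replace s' with 0 by lra. rewrite ray0. exact Hab. }
  { intros x y Hxy Hy s' Hs'. apply Hy; lra. }
  assert (before : forall s, 0 <= s < t -> ~ on_boundary n v (ray s)).
  { intros s Hs'. apply (Hlt s); lra. }
  assert (hit : on_boundary n v (ray t)).
  { apply NNPP. intros Hn. destruct (off_boundary_open n v _ Hs Hn) as (r & Hr & Hbox).
    destruct (small_comb r (fst u) (snd u) 0 0 Hr) as (d & Hd & Hsm).
    apply (Hgt (t + d / 2)); [lra|]. intros s' Hs'.
    destruct (Rlt_dec s' t) as [H|H]; [apply before; lra|].
    destruct (Hsm (s' - t) 0) as [H1 H2];
      [rewrite Rabs_pos_eq; lra|rewrite Rabs_R0; exact Hd|].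
    assert (H3 := Hbox _ _ H1 H2).
    match type of H3 with ~ on_boundary _ _ ?p => replace (ray s') with p; [exact H3|] end.
    apply point_eq; unfold ray; simpl; ring. }
  exists t. split.
  - split; [|apply Ht]. destruct (Req_dec t 0) as [E|E]; [|lra].
    exfalso. apply Hab. rewrite <- ray0, <- E. exact hit.
  - split; [exact hit|]. intros s Hs01. fold (ray t).
    assert (Er : forall x, lerp a (ray t) x = ray (x * t))
      by (intros; apply point_eq; unfold ray; simpl; ring).
    rewrite Er. destruct (Req_dec s 1) as [->|Hs1].
    + left. rewrite Rmult_1_l. exact hit.
    + assert (Hfree : forall x, 0 <= x <= s -> ~ on_boundary n v (ray (x * t))).
      { intros x Hx. apply before. split; [apply Rmult_le_pos; lra|].
        destruct (Req_dec t 0) as [E|E].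
        - exfalso. apply Hab. rewrite <- ray0, <- E. exact hit.
        - assert (0 < t * (1 - x)) by (apply Rmult_lt_0_compat; lra). lra. }
      right. split; [apply Hfree; lra|].
      apply (in_bounded_component_seg n v a); [exact Hin|]. intros x Hx.
      replace (lerp a (ray (s * t)) x) with (ray (x * s * t))
        by (apply point_eq; unfold ray; simpl; ring).
      apply Hfree. split; [apply Rmult_le_pos; lra|]. nra.
Qed.

(** An exterior point at parameter [t] has an exterior box around it, and moving [w] moves this
    point only by the factor [t]. *)
Lemma covers_closed (n : nat) (v : nat -> point) (g w : point) :
  simple_polygon n v ->
  (forall d, 0 < d -> exists x y, Rabs x < d /\ Rabs y < d /\ covers n v g (off w x y)) ->
  covers n v g w.
Proof.
  intros Hs Hlim t Ht. apply NNPP. intros Hn.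
  destruct (exterior_open n v _ Hs Hn) as (r & Hr & Hbox).
  destruct (Hlim r Hr) as (x & y & Hx & Hy & Hc).
  assert (sc : forall c, Rabs c < r -> Rabs (t * c) < r).
  { intros c Hc'. rewrite Rabs_mult, Rabs_pos_eq by lra. assert (P := Rabs_pos c). nra. }
  apply (Hbox _ _ (sc _ Hx) (sc _ Hy)).
  assert (H := Hc t Ht).
  match type of H with gallery _ _ ?p => match goal with |- gallery _ _ ?q =>
    replace q with p; [exact H|] end end.
  apply point_eq; simpl; ring.
Qed.

(** * Rays whose ends are hidden from the pockets *)

(* [u] points to the part of the view of [a] that is hidden from the pocket behind
   the corner [a + r]; the sign of [c] tells on which side of [r] the pocket is. *)
Definition hidden_dir (c : R) (r u : point) : Prop :=
  0 < c * cross r u \/ cross r u = 0 /\ dot r u <= 0.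

Lemma hidden_dir_scale (c t : R) (r u a : point) :
  0 < t -> hidden_dir c r u -> hidden_dir c r (vec a (off a (t * fst u) (t * snd u))).
Proof.
  intros Ht [H|[H1 H2]]; [left|right]; unfold cross, dot in *; simpl.
  - replace (c * _) with (t * (c * (fst r * snd u - snd r * fst u))) by ring.
    apply Rmult_lt_0_compat; lra.
  - split.
    + transitivity (t * (fst r * snd u - snd r * fst u)); [ring|]. rewrite H1. ring.
    + replace (_ + _) with (t * (fst r * fst u + snd r * snd u)) by ring. nra.
Qed.

(** For [c <> 0] the hidden directions form an open half plane together with the ray opposite to
    [r]. Two such sets meet in a nonzero direction except in the second alternative. A corner with
    [c = 0] imposes nothing. *)
Lemma hidden_dir_or_opposite (c1 c2 : R) (r1 r2 : point) :
  (c1 <> 0 -> 0 < dot r1 r1) -> (c2 <> 0 -> 0 < dot r2 r2) ->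
  (exists u, 0 < dot u u /\
     (c1 <> 0 -> hidden_dir c1 r1 u) /\ (c2 <> 0 -> hidden_dir c2 r2 u)) \/
  (exists l, l < 0 /\ r2 = (l * fst r1, l * snd r1) /\ 0 < c1 * c2).
Proof.
  destruct r1 as [x1 y1], r2 as [x2 y2]. unfold hidden_dir, dot, cross; simpl.
  intros N1 N2.
  destruct (Req_dec c1 0) as [Z1|Z1].
  { left. destruct (Req_dec c2 0) as [Z2|Z2].
    - exists (1, 0); simpl. split; [lra|]. split; intros; contradiction.
    - exists (- x2, - y2); simpl. assert (H := N2 Z2).
      split; [lra|]. split; [contradiction|]. intros _. right. split; [ring|lra]. }
  destruct (Req_dec c2 0) as [Z2|Z2].
  { left. exists (- x1, - y1); simpl. assert (H := N1 Z1).
    split; [lra|]. split; [|contradiction]. intros _. right. split; [ring|lra]. }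
  assert (P1 := N1 Z1). assert (P2 := N2 Z2).
  assert (Q1 := Rsqr_pos_lt _ Z1). assert (Q2 := Rsqr_pos_lt _ Z2). unfold Rsqr in Q1, Q2.
  pose (D := x1 * y2 - y1 * x2).
  destruct (Req_dec D 0) as [HD|HD].
  - pose (l := (x1 * x2 + y1 * y2) / (x1 * x1 + y1 * y1)).
    assert (E1 : x2 = l * x1).
    { transitivity (l * x1 - D * y1 / (x1 * x1 + y1 * y1));
        [unfold l, D; field; lra|rewrite HD; field; lra]. }
    assert (E2 : y2 = l * y1).
    { transitivity (l * y1 + D * x1 / (x1 * x1 + y1 * y1));
        [unfold l, D; field; lra|rewrite HD; field; lra]. }
    clearbody l. subst x2 y2.
    destruct (Rlt_dec l 0) as [Hl|Hl].
    + destruct (Rlt_dec 0 (c1 * c2)) as [Hc|Hc]; [right; exists l; auto|].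
      (* Opposite corners with pockets on the same side of their common line: a quarter turn of [r1]
         away from that side. *)
      left. exists (- c1 * y1, c1 * x1); simpl.
      split.
      { replace (_ + _) with (c1 * c1 * (x1 * x1 + y1 * y1)) by ring.
        apply Rmult_lt_0_compat; assumption. }
      split; intros _; left.
      * replace (c1 * _) with (c1 * c1 * (x1 * x1 + y1 * y1)) by ring.
        apply Rmult_lt_0_compat; assumption.
      * replace (c2 * _) with ((- (c1 * c2)) * (- l) * (x1 * x1 + y1 * y1)) by ring.
        assert (c1 * c2 <> 0) by (apply Rmult_integral_contrapositive; auto).
        repeat apply Rmult_lt_0_compat; lra.
    + left. exists (- x1, - y1); simpl. split; [lra|].
      split; intros _; right; (split; [ring|]); [lra|]. nra.
  - left. assert (QD := Rsqr_pos_lt _ HD). unfold Rsqr in QD.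
    (* This is [D] times [c1 r2 - c2 r1]; its cross products with [r1] and [r2] are [c1 D^2] and
       [c2 D^2]. *)
    exists (c1 * D * x2 - c2 * D * x1, c1 * D * y2 - c2 * D * y1); simpl.
    assert (H1 : 0 < c1 * (x1 * (c1 * D * y2 - c2 * D * y1) - y1 * (c1 * D * x2 - c2 * D * x1))).
    { replace (c1 * _) with (c1 * c1 * (D * D)) by (unfold D; ring).
      apply Rmult_lt_0_compat; assumption. }
    assert (H2 : 0 < c2 * (x2 * (c1 * D * y2 - c2 * D * y1) - y2 * (c1 * D * x2 - c2 * D * x1))).
    { replace (c2 * _) with (c2 * c2 * (D * D)) by (unfold D; ring).
      apply Rmult_lt_0_compat; assumption. }
    split; [|split; intros _; left; assumption].
    apply sqr_sum_pos. apply NNPP. intros H.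
    set (u1 := c1 * D * x2 - c2 * D * x1) in *. set (u2 := c1 * D * y2 - c2 * D * y1) in *.
    destruct (Req_dec u1 0) as [E1|]; [|tauto]. destruct (Req_dec u2 0) as [E2|]; [|tauto].
    rewrite E1, E2 in H1. lra.
Qed.

Lemma bounded_cluster_point (x : nat -> R) (m M : R) :
  (forall k, m <= x k <= M) -> exists l, m <= l /\
    forall d N, 0 < d -> exists k, (N <= k)%nat /\ Rabs (x k - l) < d.
Proof.
  intros H.
  destruct (Bolzano_Weierstrass x (fun c => m <= c <= M) (compact_P3 m M) H) as (l & Hl).
  assert (Hl' : forall d N, 0 < d -> exists k, (N <= k)%nat /\ Rabs (x k - l) < d).
  { intros d N Hd. apply (Hl (fun y => Rabs (y - l) < d) N).
    exists (mkposreal d Hd). intros y Hy. exact Hy. }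
  exists l. split; [|exact Hl'].
  apply Rnot_lt_le. intros Hlt. destruct (Hl' (m - l) 0%nat ltac:(lra)) as (k & _ & Hk).
  apply Rabs_def2 in Hk. assert (Hm := H k). lra.
Qed.

Lemma small_enough_for_all {A : Type} (F : list A) (P : A -> R -> Prop) :
  (forall g, In g F -> exists e0, 0 < e0 /\ forall e, 0 < e < e0 -> P g e) ->
  exists e, 0 < e /\ forall g, In g F -> P g e.
Proof.
  intros H.
  assert (H' : exists e0, 0 < e0 /\ forall e, 0 < e < e0 -> forall g, In g F -> P g e).
  { induction F as [|g F IH].
    - exists 1. split; [lra|]. intros e _ g [].
    - destruct (H g (or_introl eq_refl)) as (e1 & He1 & H1).
      destruct IH as (e2 & He2 & H2).
      { intros g' Hg'. apply H. right; exact Hg'. }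
      exists (Rmin e1 e2). split; [apply Rmin_glb_lt; assumption|].
      assert (M1 := Rmin_l e1 e2). assert (M2 := Rmin_r e1 e2).
      intros e He g' [<-|Hg']; [apply H1|apply H2]; try assumption; lra. }
  destruct H' as (e0 & He0 & H'). exists (e0 / 2). split; [lra|]. apply H'. lra.
Qed.

(* [r2] is the direction of the second corner, opposite to the first one, and is
   tilted to the side on which its own pocket lies. *)
Lemma tilted_ray_hidden (n : nat) (v : nat -> point) (a g : point)
    (c1 c2 l T : R) (r1 r2 : point) :
  simple_polygon n v ->
  l < 0 -> r2 = (l * fst r1, l * snd r1) -> 0 < c1 * c2 -> 0 < dot r2 r2 ->
  (forall w, covers n v a w -> covers n v g w ->
     0 < c1 * cross r1 (vec a g) /\ ~ hidden_dir c1 r1 (vec a w) \/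
     0 < c2 * cross r2 (vec a g) /\ ~ hidden_dir c2 r2 (vec a w)) ->
  exists e0, 0 < e0 /\ forall e, 0 < e < e0 -> forall t, 0 < t <= T ->
    let u := (fst r2 - e * c2 * snd r2, snd r2 + e * c2 * fst r2) in
    let w := off a (t * fst u) (t * snd u) in
    covers n v a w -> ~ covers n v g w.
Proof.
  intros Hs Hl Hr Hc Hr2 Hblock. apply NNPP. intros Hn.
  pose (W := fun e t => off a (t * (fst r2 - e * c2 * snd r2)) (t * (snd r2 + e * c2 * fst r2))).
  (* If the claim fails, the guard sees ends of rays with tilts tending to 0 and lengths at most
     [T]. *)
  assert (Hseq : forall k : nat, exists p : R * R,
    0 < fst p < / (INR k + 1) /\ 0 < snd p <= T /\
    covers n v a (W (fst p) (snd p)) /\ covers n v g (W (fst p) (snd p))).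
  { intros k. apply NNPP. intros Hk. apply Hn. exists (/ (INR k + 1)).
    split; [apply Rinv_0_lt_compat; assert (H := pos_INR k); lra|].
    intros e He t Ht. cbv zeta. intros Ha Hg. apply Hk. exists (e, t). auto. }
  pose (p := fun k => proj1_sig (constructive_indefinite_description _ (Hseq k))).
  assert (Hp : forall k, 0 < fst (p k) < / (INR k + 1) /\ 0 < snd (p k) <= T /\
    covers n v a (W (fst (p k)) (snd (p k))) /\ covers n v g (W (fst (p k)) (snd (p k)))).
  { intros k. exact (proj2_sig (constructive_indefinite_description _ (Hseq k))). }
  clearbody p.
  (* A positive tilt hides the end from the second pocket, so the first corner is the one that
     blocks. *)
  assert (Hg1 : 0 < c1 * cross r1 (vec a g)).
  { destruct (Hp 0%nat) as (He & Ht & Ha & Hg).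
    destruct (Hblock _ Ha Hg) as [[H _]|[_ H]]; [exact H|].
    exfalso. apply H. left. unfold W, cross; simpl.
    set (e := fst (p 0%nat)) in *. set (t := snd (p 0%nat)) in *.
    replace (c2 * _) with (t * e * (c2 * c2) * dot r2 r2) by (unfold dot; ring).
    assert (c2 <> 0) by (intros E; rewrite E in Hc; lra).
    assert (0 < c2 * c2) by (apply Rsqr_pos_lt; assumption).
    apply Rmult_lt_0_compat; [|exact Hr2].
    apply Rmult_lt_0_compat; [|assumption]. apply Rmult_lt_0_compat; lra. }
  destruct (bounded_cluster_point (fun k => snd (p k)) 0 T) as (t & Ht0 & Ht).
  { intros k. destruct (Hp k) as (_ & H & _). lra. }
  (* A common index makes the length close to [t] and the tilt small; the end then differs from
     [W 0 t] by a small combination of [r2] and its quarter turn. *)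
  assert (Hlim : forall q, (forall k, covers n v q (W (fst (p k)) (snd (p k)))) ->
    covers n v q (W 0 t)).
  { intros q Hq. apply covers_closed; [exact Hs|]. intros r Pr.
    destruct (small_comb r (fst r2) (snd r2) (- c2 * snd r2) (c2 * fst r2) Pr) as (d & Hd & Hsm).
    assert (HT : 0 < T) by (destruct (Hp 0%nat) as (_ & H & _); lra).
    destruct (archimed_cor1 (d / T)) as (N & HN & HN0); [apply Rdiv_lt_0_compat; lra|].
    destruct (Ht d N Hd) as (k & Hk & Htk). destruct (Hp k) as (He & Htk' & _).
    assert (HeN : fst (p k) < d / T).
    { apply Rlt_trans with (2 := HN). apply Rlt_le_trans with (1 := proj2 He).
      apply Rinv_le_contravar; [apply lt_0_INR; exact HN0|].
      apply le_INR in Hk. lra. }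
    assert (Hd' : d / T * T = d) by (field; lra).
    destruct (Hsm (snd (p k) - t) (snd (p k) * fst (p k)) Htk) as [H1 H2].
    { rewrite Rabs_pos_eq by (apply Rmult_le_pos; lra).
      apply Rle_lt_trans with (T * fst (p k)); [apply Rmult_le_compat_r; lra|].
      rewrite <- Hd', Rmult_comm. apply Rmult_lt_compat_r; lra. }
    do 2 eexists. split; [exact H1|]. split; [exact H2|].
    assert (H := Hq k).
    match type of H with covers _ _ _ ?x => match goal with |- covers _ _ _ ?y =>
      replace y with x; [exact H|] end end.
    apply point_eq; unfold W; simpl; ring. }
  (* Neither corner can block at the limit. [W 0 t] is opposite to the first one as seen from [a],
     and by [Hg1] together with [l < 0] and [0 < c1 * c2] the guard is on the wrong side of the
     second one. *)
  destruct (Hblock (W 0 t)) as [[_ H]|[H _]].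
  - apply Hlim. apply Hp.
  - apply Hlim. apply Hp.
  - apply H. right. unfold W, cross, dot; simpl. rewrite Hr; simpl.
    split; [ring|].
    replace (_ + _) with (l * (t * (fst r1 * fst r1 + snd r1 * snd r1))) by ring.
    assert (0 <= t * (fst r1 * fst r1 + snd r1 * snd r1)); [|nra].
    apply Rmult_le_pos; [exact Ht0|].
    assert (A := Rle_0_sqr (fst r1)). assert (B := Rle_0_sqr (snd r1)).
    unfold Rsqr in A, B. lra.
  - set (X := cross r1 (vec a g)) in *.
    assert (EX : cross r2 (vec a g) = l * X) by (rewrite Hr; unfold X, cross; simpl; ring).
    rewrite EX in H. replace (c2 * (l * X)) with (l * (c2 * X)) in H by ring.
    assert (c1 * X * (c2 * X) = c1 * c2 * (X * X)) by ring.
    assert (0 <= X * X) by apply (Rle_0_sqr X).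
    assert (0 <= c1 * X * (c2 * X)) by nra.
    assert (c2 * X < 0) by nra. nra.
Qed.

Theorem theorem1 : forall (n : nat) (v : nat -> point),
  simple_polygon n v -> at_most_two_reflex n v -> normal n v.
Proof.
  intros n v Hs (L & HL & Href) F HF Hwall a Ha.
  destruct (classic (on_boundary n v a)) as [Hab|Hab]; [exact (Hwall a Hab)|].
  assert (Hin : in_bounded_component n v a) by (destruct Ha as [|[]]; tauto).
  apply NNPP. intros Hnone.
  assert (Hun : forall g, In g F -> ~ covers n v g a).
  { intros g Hg Hc. apply Hnone. exists g. auto. }
  (* A list with fewer than two entries is padded with vertex 0, which merely adds a direction to be
     avoided. *)
  set (r := fun j => vec a (v (nth j L 0%nat))).
  set (c := fun j => cross (r j) (corner_dir n v (nth j L 0%nat))).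
  assert (Hr : forall j, c j <> 0 -> 0 < dot (r j) (r j)).
  { intros j Hj. apply sqr_sum_pos. apply NNPP. intros H. apply Hj. unfold c, cross.
    destruct (Req_dec (fst (r j)) 0) as [E1|]; [|tauto].
    destruct (Req_dec (snd (r j)) 0) as [E2|]; [|tauto].
    rewrite E1, E2. ring. }
  assert (Hblock : forall g w, In g F -> covers n v a w -> covers n v g w ->
     0 < c 0%nat * cross (r 0%nat) (vec a g) /\ ~ hidden_dir (c 0%nat) (r 0%nat) (vec a w) \/
     0 < c 1%nat * cross (r 1%nat) (vec a g) /\ ~ hidden_dir (c 1%nat) (r 1%nat) (vec a w)).
  { intros g w Hg Haw Hgw.
    destruct (blocking_corner n v a w g Hs Ha Hab Haw Hgw (Hun g Hg)) as (i & Hi & Hri & H).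
    assert (Hj : exists j, (j = 0 \/ j = 1)%nat /\ i = nth j L 0%nat).
    { assert (HiL := Href i Hi Hri).
      destruct L as [|i1 [|i2 [|]]]; simpl in HiL, HL; try lia.
      - destruct HiL as [E|[]]. exists 0%nat; simpl; auto.
      - destruct HiL as [E|[E|[]]]; [exists 0%nat|exists 1%nat]; simpl; auto. }
    destruct Hj as (j & Hj & ->). cbv zeta in H. fold (r j) in H. fold (c j) in H.
    (* The position of [w] given by [blocking_corner] is exactly what [hidden_dir] excludes. *)
    assert (Hnh : ~ hidden_dir (c j) (r j) (vec a w)).
    { intros [A|[A B]]; destruct H as [_ [C|[C D]]]; try lra.
      - rewrite C in A. lra.
      - rewrite A in C. lra. }
    destruct Hj as [-> | ->]; [left|right]; tauto. }
  destruct (ray_hit n v a Hs Hab Hin) as (K & HK & Hray).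
  assert (cnz : forall j x, 0 < c j * x -> c j <> 0).
  { intros j x H E. rewrite E in H. lra. }
  destruct (hidden_dir_or_opposite (c 0%nat) (c 1%nat) (r 0%nat) (r 1%nat) (Hr _) (Hr _))
    as [(u & Hu & G0 & G1)|(l & Hl & El & Hc)].
  - destruct (Hray u Hu) as (t & Ht & Hb & Hc).
    destruct (Hwall _ Hb) as (g & Hg & Hgw).
    destruct (Hblock g _ Hg Hc Hgw) as [[H1 H2]|[H1 H2]];
      apply H2, hidden_dir_scale; try apply Ht; [apply G0|apply G1]; eapply cnz; exact H1.
  - assert (Hr2 : 0 < dot (r 1%nat) (r 1%nat)).
    { apply Hr. intros E. rewrite E in Hc. lra. }
    set (R2 := r 1%nat) in *. set (N := dot R2 R2) in *.
    destruct (small_enough_for_all F (fun g e => forall t, 0 < t <= K / N + 1 ->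
      let u := (fst R2 - e * c 1%nat * snd R2, snd R2 + e * c 1%nat * fst R2) in
      let w := off a (t * fst u) (t * snd u) in
      covers n v a w -> ~ covers n v g w)) as (e & He & HFe).
    { intros g Hg.
      apply (tilted_ray_hidden n v a g (c 0%nat) (c 1%nat) l (K / N + 1) (r 0%nat) R2);
        try assumption.
      intros w. apply Hblock, Hg. }
    set (u := (fst R2 - e * c 1%nat * snd R2, snd R2 + e * c 1%nat * fst R2)) in *.
    (* Tilting adds a vector orthogonal to [R2], hence lengthens it, and the bound [K / N + 1] holds
       for every tilt. *)
    assert (Hdu : N <= dot u u).
    { assert (E : dot u u = N + e * c 1%nat * (e * c 1%nat) * N)
        by (unfold u, N, dot; simpl; ring).
      assert (A := Rle_0_sqr (e * c 1%nat)). unfold Rsqr in A.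
      assert (0 <= e * c 1%nat * (e * c 1%nat) * N) by (apply Rmult_le_pos; lra). lra. }
    destruct (Hray u ltac:(lra)) as (t & Ht & Hb & Hcv).
    destruct (Hwall _ Hb) as (g & Hg & Hgw).
    refine (HFe g Hg t _ Hcv Hgw).
    split; [lra|]. apply Rle_trans with (1 := proj2 Ht).
    apply Rplus_le_compat_r. unfold Rdiv. apply Rmult_le_compat_l; [exact HK|].
    apply Rinv_le_contravar; lra.
Qed.
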